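(* $\mathcal{P}_{Ind_{AB}}$ privately computes (with respect to semi-honest parties) the function $Ind_{AB}$ with communication costs $C_{\mathrm{OT}}(w,k,Y)$, computation costs $O(W_{\mathrm{OT}}(w,k,Y))$ and the round complexity of the oblivious transfer protocol.
   Context: **Private indirect indexing.** Let $w$ be a power of $2$, $\bar y=y[0],\dots,y[w-1]$ with $y[i]\in\{0,1\}^Y$, $j\in\{0,\dots,w-1\}$ (identified with a string in $\{0,1\}^{\log w}$), and $\pi\in\{0,1\}^{\log w}$ arbitrary. Define the randomized functionality $$Ind_{AB}(\pi\oplus j,(\pi,\bar y))=(\pi'\oplus y[j],\pi'),\qquad\pi'\in_R\{0,1\}^Y\text{ uniform},$$ with the first argument and output belonging to Alice and the second to Bob. **Protocol $\mathcal{P}_{Ind_{AB}}$.** Alice's input is $J=\pi\oplus j$; Bob's input is $(\pi,\bar y)$. Bob chooses $\pi'\in_R\{0,1\}^Y$ and sets $\mathcal{Y}[\pi\oplus i]=\pi'\oplus y[i]$ for $0\le i<w$. Alice (chooser, with index $J$) and Bob (sender, with $\mathcal{Y}[0],\dots,\mathcal{Y}[w-1]$) run a 1-out-of-$w$ oblivious transfer protocol, so that Alice learns $J'=\mathcal{Y}[J]$. Alice outputs $J'$ and Bob outputs $\pi'$. **Privacy (semi-honest).** For a (possibly randomized) functionality $g(x,y)=(g_1(x,y),g_2(x,y))$, a protocol $\mathcal{P}$ privately computes $g$ if there are probabilistic polynomial-time simulators $S_1,S_2$ with $\{(S_1(x,g_1(x,y)),g_2(x,y))\}\stackrel{c}{\equiv}\{(\mathrm{VIEW}_1^{\mathcal{P}}(x,y),\mathrm{OUT}_2^{\mathcal{P}}(x,y))\}$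 and $\{(S_2(y,g_2(x,y)),g_1(x,y))\}\stackrel{c}{\equiv}\{(\mathrm{VIEW}_2^{\mathcal{P}}(x,y),\mathrm{OUT}_1^{\mathcal{P}}(x,y))\}$. Here $\mathrm{VIEW}_i$ is party $i$'s view (input, private coins and received messages) when both follow $\mathcal{P}$, $\mathrm{OUT}_i$ is its output, and $\stackrel{c}{\equiv}$ is computational indistinguishability by polynomial-size circuits. The security parameter $k$ is chosen so that the parties' work does not suffice to break the primitives in use. **Oblivious transfer.** A 1-out-of-$w$ OT protocol, i.e. one privately computing $((x[0],\dots,x[w-1]),j)\mapsto(\bot,x[j])$ for $x[i]\in\{0,1\}^X$, is assumed given, with work $W_{\mathrm{OT}}(w,k,X)$ (at least linear in the total input length $wX$) and communication $C_{\mathrm{OT}}(w,k,X)$. *)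

(* Defs.v *)
From mathcomp Require Import all_boot all_order all_algebra.

Set Implicit Arguments.
Unset Strict Implicit.
Unset Printing Implicit Defensive.

Import Order.TTheory GRing.Theory Num.Theory.

(** * Parameters

    [w = 2 ^ logw] is the number of strings, [sec] the security parameter [k]
    and [len] the length [X] (or [Y]) of each string.  They are public. *)

Record param := Param {
  logw : nat;
  sec : nat;
  len : nat;
  len_gt0 : 0 < len
}.

Definition width (p : param) : nat := 2 ^ logw p.

(** * Machines

    Parties and simulators are programs of a unit-cost RAM with registers and
    growable arrays, all holding natural numbers.  There is no multiplication
    and no shift, so the bit length of the contents grows by at most one per
    step and the polynomial-time computable functions are the usual ones.
    Registers and arrays are named by natural numbers. *)

Inductive cmd :=
| Skip
| Const (x n : nat)            (* x := n *)
| Plus (x y z : nat)           (* x := y + z *)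
| Minus (x y z : nat)          (* x := y - z, truncated at 0 *)
| Xor (x y z : nat)            (* x := bitwise exclusive or of y and z *)
| Len (x a : nat)              (* x := length of array a *)
| Get (x a i : nat)            (* x := a[i], or 0 if out of range *)
| Store (a i x : nat)          (* a[i] := x, no effect if out of range *)
| Push (a x : nat)             (* append x at the end of a *)
| Toss (x : nat)               (* x := a fresh random bit *)
| Yield                        (* send the outbox, wait for a reply *)
| Seq (c d : cmd)
| Cond (x : nat) (c d : cmd)   (* c if x <> 0, d otherwise *)
| While (x : nat) (c : cmd).   (* as long as x <> 0 *)

Notation "c ;; d" := (Seq c d) (at level 90, right associativity).

(** [tape] holds the random bits not yet used, [tossed] those already used. *)
Record memory := Memory {
  reg : nat -> nat;
  arr : nat -> seq nat;
  tape : bitseq;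
  tossed : bitseq
}.

Definition upd (T : eqType) (V : Type) (f : T -> V) (x : T) (v : V) : T -> V :=
  fun y => if y == x then v else f y.

Definition set_reg (m : memory) (x v : nat) : memory :=
  Memory (upd (reg m) x v) (arr m) (tape m) (tossed m).

Definition set_arr (m : memory) (a : nat) (s : seq nat) : memory :=
  Memory (reg m) (upd (arr m) a s) (tape m) (tossed m).

Definition toss (m : memory) (x : nat) : memory :=
  let b := head false (tape m) in
  Memory (upd (reg m) x (nat_of_bool b)) (arr m)
         (behead (tape m)) (rcons (tossed m) b).

(** A thread is the list of commands still to be executed and a memory; it has
    halted when the list is empty.  A step of a thread is the unit of work.
    [Yield] is intercepted by the joint execution of a protocol; it has no
    effect in a machine running alone. *)
Definition thread := (seq cmd * memory)%type.

Definition tick (t : thread) : thread :=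
  let: (K, m) := t in
  match K with
  | [::] => t
  | c :: K =>
    match c with
    | Skip => (K, m)
    | Const x n => (K, set_reg m x n)
    | Plus x y z => (K, set_reg m x (reg m y + reg m z))
    | Minus x y z => (K, set_reg m x (reg m y - reg m z))
    | Xor x y z => (K, set_reg m x (Nat.lxor (reg m y) (reg m z)))
    | Len x a => (K, set_reg m x (size (arr m a)))
    | Get x a i => (K, set_reg m x (nth 0 (arr m a) (reg m i)))
    | Store a i x =>
        (K, if reg m i < size (arr m a)
            then set_arr m a (set_nth 0 (arr m a) (reg m i) (reg m x)) else m)
    | Push a x => (K, set_arr m a (rcons (arr m a) (reg m x)))
    | Toss x => (K, toss m x)
    | Yield => (K, m)
    | Seq c1 c2 => (c1 :: c2 :: K, m)
    | Cond x c1 c2 => ((if reg m x != 0 then c1 else c2) :: K, m)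
    | While x c1 => (if reg m x != 0 then c1 :: c :: K else K, m)
    end
  end.

Definition halted (t : thread) : bool := nilp t.1.

(** Conventions: the public parameters are in the first four registers, the
    first four arrays are the input, the output, the last message received and
    the message being prepared.  Everything else is initially 0 or empty.
    Strings are stored one bit per cell; a cell is read back as the bit
    [cell != 0]. *)
Definition rW := 0.
Definition rLogW := 1.
Definition rSec := 2.
Definition rLen := 3.
Definition aIn := 0.
Definition aOut := 1.
Definition aInbox := 2.
Definition aOutbox := 3.

Definition cells (s : bitseq) : seq nat := [seq nat_of_bool b | b <- s].
Definition bits (s : seq nat) : bitseq := [seq n != 0 | n <- s].

Definition load (p : param) (z r : bitseq) : memory :=
  Memory (nth 0 [:: width p; logw p; sec p; len p])
         (fun a => if a == aIn then cells z else [::]) r [::].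

(** The result of running [c] for [t] steps on input [z] and random tape [r]. *)
Definition run (c : cmd) (t : nat) (p : param) (z r : bitseq) : thread :=
  iter t tick ([:: c], load p z r).

(** * Two-party protocols

    Party 1 is designated by [false] and party 2 by [true].  The parties are
    active in turn: the active party computes until it executes [Yield], which
    transmits its outbox and activates the other one.  A party that has
    finished hands over at once, and the execution is over when both have
    finished. *)

Record protocol := Protocol {
  party1 : cmd;
  party2 : cmd;
  first : bool                 (* the party that is active first *)
}.

(** [log] is the list of messages sent so far, with their senders. *)
Record conf := Conf {
  turn : bool;
  thr : bool -> thread;
  log : seq (bool * bitseq)
}.

Definition finished (c : conf) : bool :=
  halted (thr c false) && halted (thr c true).

Definition jstep (c : conf) : conf :=
  let i := turn c in
  let: (K, m) := thr c i in
  match K with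
  | [::] => if finished c then c else Conf (~~ i) (thr c) (log c)
  | Yield :: K' =>
    let msg := bits (arr m aOutbox) in
    let: (K2, m2) := thr c (~~ i) in
    Conf (~~ i)
      (fun j => if j == i then (K', set_arr m aOutbox [::])
                else (K2, set_arr m2 aInbox (cells msg)))
      (rcons (log c) (i, msg))
  | _ => Conf i (upd (thr c) i (tick (K, m))) (log c)
  end.

Definition start (P : protocol) (p : param) (x y r1 r2 : bitseq) : conf :=
  Conf (first P)
    (fun i => if i then ([:: party2 P], load p y r2)
              else ([:: party1 P], load p x r1))
    [::].

(** The state after [t] joint steps, on inputs [x], [y] and tapes [r1], [r2]. *)
Definition execute (P : protocol) (t : nat) (p : param) (x y r1 r2 : bitseq) :
  conf := iter t jstep (start P p x y r1 r2).

Definition communication (c : conf) : nat := \sum_(e <- log c) size e.2.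

(** One round per message: the parties speak in turn. *)
Definition rounds (c : conf) : nat := size (log c).

(** The output of party [i], a string of [n] bits. *)
Definition output (n : nat) (c : conf) (i : bool) : bitseq :=
  mkseq (fun q => nth 0 (arr (thr c i).2 aOut) q != 0) n.

(** Self-delimiting encoding of a string. *)
Definition encode (s : bitseq) : bitseq :=
  flatten [seq [:: true; b] | b <- s] ++ [:: false; true].

(** The view of party [i] with input [x]: its input, the coins it has tossed
    and the messages it has received, encoded as one string. *)
Definition view (x : bitseq) (c : conf) (i : bool) : bitseq :=
  encode x ++ encode (tossed (thr c i).2)
    ++ flatten [seq encode e.2 | e <- log c & e.1 == ~~ i].

(** * Functionalities

    [value p q x y] is the pair of outputs on inputs [x], [y] when the internal
    random choice, uniform in [choice p], is [q]. *)

Record functionality := Functionality {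
  input1 : param -> finType;
  input2 : param -> finType;
  code1 : forall p, input1 p -> bitseq;
  code2 : forall p, input2 p -> bitseq;
  outlen1 : param -> nat;
  outlen2 : param -> nat;
  choice : param -> finType;
  value : forall p, choice p -> input1 p -> input2 p ->
            (outlen1 p).-tuple bool * (outlen2 p).-tuple bool
}.

(** * Computational indistinguishability *)

(** The uniform distribution on [outcome], transported by [sample]. *)
Record distribution := Distribution {
  outcome : finType;
  sample : outcome -> bitseq
}.

(** Boolean circuits, as lists of gates.  [Nand i j] refers to the values of
    gates [i] and [j], which must come earlier in the list (otherwise the value
    read is [false]); the output is that of the last gate.  Input bits past the
    end of the input string are [false]. *)
Inductive gate := Input (i : nat) | Constant (b : bool) | Nand (i j : nat).

Definition circuit := seq gate.

Definition gate_value (s vals : bitseq) (g : gate) : bool :=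
  match g with
  | Input i => nth false s i
  | Constant b => b
  | Nand i j => ~~ (nth false vals i && nth false vals j)
  end.

Definition accepts (C : circuit) (s : bitseq) : bool :=
  last false (foldl (fun vals g => rcons vals (gate_value s vals g)) [::] C).

Definition prob_accept (C : circuit) (D : distribution) : rat :=
  (#|[set e : outcome D | accepts C (sample e)]|%:R / #|outcome D|%:R)%R.

(** Polynomials in [k] are represented by the monomials [k ^ d]: the strings,
    their number, the circuits and the inverse of the advantage are all
    polynomial in the security parameter. *)
Definition indistinguishable (I : param -> Type)
    (D E : forall p, I p -> distribution) : Prop :=
  forall d : nat, exists K : nat, forall p : param,
    K <= sec p -> width p <= sec p ^ d -> len p <= sec p ^ d ->
    forall (i : I p) (C : circuit), size C <= sec p ^ d ->
    (`| prob_accept C (D p i) - prob_accept C (E p i) |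
       < ((sec p ^ d)%:R)^-1)%R.

(** * Privacy against semi-honest parties *)

(** The security parameter is given in unary, hence [sec p] itself and not its
    length; the input lengths are polynomial in [width p] and [len p]. *)
Definition poly_bound (d : nat) (p : param) : nat := (width p + sec p + len p) ^ d.

(** [S] is a probabilistic algorithm, on inputs in [I], with running time
    bounded by [poly_bound d]. *)
Definition poly_time (I : param -> Type) (code : forall p, I p -> bitseq)
    (S : cmd) (d : nat) : Prop :=
  forall (p : param) (z : I p) (r : (poly_bound d p).-tuple bool),
    halted (run S (poly_bound d p) p (code p z) r).

(** What [S] writes on input [z], with random tape [r]. *)
Definition sim_output (S : cmd) (d : nat) (p : param) (z r : bitseq) : bitseq :=
  bits (arr (run S (poly_bound d p) p z r).2 aOut).

(** [W] bounds the total number of steps of both parties, whatever the inputs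
    and the coins. *)
Definition has_work (F : functionality) (P : protocol) (W : param -> nat) :
    Prop :=
  forall (p : param) (x : input1 F p) (y : input2 F p)
         (r1 r2 : (W p).-tuple bool),
    finished (execute P (W p) p (code1 x) (code2 y) r1 r2).

(** [W] is meant to be a bound on the work of [P], as in [has_work].  A step
    uses at most one coin, so with random tapes of length [W p] the parties
    never run out of coins and the distributions do not depend on [W].

    In all four distributions the output of the other party comes before the
    view.  Its length is fixed, so that this is an encoding of the pair. *)
Section Privacy.

Variables (F : functionality) (P : protocol) (W : param -> nat).

Definition final (p : param) (x : input1 F p) (y : input2 F p)
    (r : (W p).-tuple bool * (W p).-tuple bool) : conf :=
  execute P (W p) p (code1 x) (code2 y) r.1 r.2.

Definition real_dist1 (p : param) (i : input1 F p * input2 F p) : distribution :=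
  @Distribution ((W p).-tuple bool * (W p).-tuple bool)%type
    (fun r => let c := final i.1 i.2 r in
       output (outlen2 F p) c true ++ view (code1 i.1) c false).

Definition real_dist2 (p : param) (i : input1 F p * input2 F p) : distribution :=
  @Distribution ((W p).-tuple bool * (W p).-tuple bool)%type
    (fun r => let c := final i.1 i.2 r in
       output (outlen1 F p) c false ++ view (code2 i.2) c true).

(** The input of a simulator is the input of the party followed by its output. *)
Definition sim_code1 (p : param)
    (z : input1 F p * (outlen1 F p).-tuple bool) : bitseq := code1 z.1 ++ z.2.

Definition sim_code2 (p : param)
    (z : input2 F p * (outlen2 F p).-tuple bool) : bitseq := code2 z.1 ++ z.2.

Definition ideal_dist1 (S : cmd) (d : nat) (p : param)
    (i : input1 F p * input2 F p) : distribution :=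
  @Distribution (choice F p * (poly_bound d p).-tuple bool)%type
    (fun e => let v := value e.1 i.1 i.2 in
       v.2 ++ sim_output S d p (sim_code1 (i.1, v.1)) e.2).

Definition ideal_dist2 (S : cmd) (d : nat) (p : param)
    (i : input1 F p * input2 F p) : distribution :=
  @Distribution (choice F p * (poly_bound d p).-tuple bool)%type
    (fun e => let v := value e.1 i.1 i.2 in
       v.1 ++ sim_output S d p (sim_code2 (i.2, v.2)) e.2).

Definition privately_computes : Prop :=
  (exists (S1 : cmd) (d : nat),
     poly_time sim_code1 S1 d /\ indistinguishable (ideal_dist1 S1 d) real_dist1) /\
  (exists (S2 : cmd) (d : nat),
     poly_time sim_code2 S2 d /\ indistinguishable (ideal_dist2 S2 d) real_dist2).

(** Worst-case costs over all inputs and coins. *)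
Definition comm_cost (p : param) : nat :=
  \max_(i : input1 F p * input2 F p)
    \max_(r : (W p).-tuple bool * (W p).-tuple bool)
      communication (final i.1 i.2 r).

Definition round_cost (p : param) : nat :=
  \max_(i : input1 F p * input2 F p)
    \max_(r : (W p).-tuple bool * (W p).-tuple bool)
      rounds (final i.1 i.2 r).

End Privacy.

(** * Oblivious transfer and indirect indexing *)

(** The index represented by a string, least significant bit first. *)
Definition string_value (l : nat) (s : l.-tuple bool) : nat :=
  \sum_(b < l) tnth s b * 2 ^ b.

Lemma string_value_lt (l : nat) (s : l.-tuple bool) : string_value s < 2 ^ l.
Proof.
rewrite -(prednK (expn_gt0 2 l)) ltnS predn_exp mul1n.
by apply: leq_sum => i _; case: (tnth s i); rewrite ?mul1n ?mul0n.
Qed.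

Definition string_index (l : nat) (s : l.-tuple bool) : 'I_(2 ^ l) :=
  Ordinal (string_value_lt s).

Definition xort (n : nat) (a b : n.-tuple bool) : n.-tuple bool :=
  [tuple tnth a i (+) tnth b i | i < n].

Definition strings (p : param) : finType :=
  (width p).-tuple ((len p).-tuple bool).

Definition code_strings (p : param) (x : strings p) : bitseq :=
  flatten [seq tval s | s <- x].

(** 1-out-of-w oblivious transfer; the empty output of the sender is the empty
    string. *)
Definition OT : functionality :=
  @Functionality strings (fun p => (logw p).-tuple bool)
    code_strings (fun p j => tval j)
    (fun=> 0) len (fun=> unit)
    (fun p _ x j => ([tuple], tnth x (string_index j))).

(** Since Alice's input is [J = pi (+) j], the index is [j = pi (+) J]. *)
Definition Ind : functionality :=
  @Functionality (fun p => (logw p).-tuple bool)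
    (fun p => ((logw p).-tuple bool * strings p)%type)
    (fun p J => tval J) (fun p y => tval y.1 ++ code_strings y.2)
    len len (fun p => (len p).-tuple bool)
    (fun p pi' J y =>
       (xort pi' (tnth y.2 (string_index (xort y.1 J))), pi')).

(** * The protocol for indirect indexing *)

Fixpoint rename (fr fa : nat -> nat) (c : cmd) : cmd :=
  match c with
  | Skip => Skip
  | Const x n => Const (fr x) n
  | Plus x y z => Plus (fr x) (fr y) (fr z)
  | Minus x y z => Minus (fr x) (fr y) (fr z)
  | Xor x y z => Xor (fr x) (fr y) (fr z)
  | Len x a => Len (fr x) (fa a)
  | Get x a i => Get (fr x) (fa a) (fr i)
  | Store a i x => Store (fa a) (fr i) (fr x)
  | Push a x => Push (fa a) (fr x)
  | Toss x => Toss (fr x)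
  | Yield => Yield
  | Seq c d => Seq (rename fr fa c) (rename fr fa d)
  | Cond x c d => Cond (fr x) (rename fr fa c) (rename fr fa d)
  | While x c => While (fr x) (rename fr fa c)
  end.

(** The sender of the oblivious transfer works on its own registers and arrays,
    except for the parameters and the messages. *)
Definition sub_reg (x : nat) : nat := if x < 4 then x else x + 16.
Definition sub_arr (a : nat) : nat :=
  if (a == aInbox) || (a == aOutbox) then a else a + 8.

Definition rI := 4.
Definition rT := 5.
Definition rJ := 6.
Definition rU := 7.
Definition rB := 8.
Definition rC := 9.
Definition rPi := 10.
Definition rPow := 11.
Definition rPos := 12.
Definition aPos := 4.

(** For [i] from 0 to [n - 1], where [n] is a register; [t] is a scratch
    register. *)
Definition For (i n t : nat) (c : cmd) : cmd :=
  Const i 0 ;; Minus t n i ;;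
  While t (c ;; Const t 1 ;; Plus i i t ;; Minus t n i).

(** The output array receives pi'. *)
Definition choose_mask : cmd :=
  For rI rLen rT (Toss rB ;; Push aOut rB).

(** The number represented by pi, the first [logw] bits of the input. *)
Definition read_pi : cmd :=
  Const rPi 0 ;; Const rPow 1 ;;
  For rI rLogW rT
    (Get rB aIn rI ;; Cond rB (Plus rPi rPi rPow) Skip ;; Plus rPow rPow rPow).

(** [aPos[i]] is the position of y[i] in the input. *)
Definition positions : cmd :=
  Const rPos 0 ;; Plus rPos rPos rLogW ;;
  For rI rW rT (Push aPos rPos ;; Plus rPos rPos rLen).

(** The string number m = pi (+) i offered in the oblivious transfer is
    pi' (+) y[i], where i = pi (+) m; they are produced in the order of m. *)
Definition mask_strings : cmd :=
  For rI rW rT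
    (Xor rPos rPi rI ;; Get rPos aPos rPos ;;
     For rJ rLen rU
       (Get rB aIn rPos ;; Get rC aOut rJ ;; Xor rB rC rB ;;
        Push (sub_arr aIn) rB ;; Const rC 1 ;; Plus rPos rPos rC)).

(** Alice, party 1, is the chooser (party 2) of the oblivious transfer. *)
Definition P_Ind (Q : protocol) : protocol :=
  Protocol (party2 Q)
    (choose_mask ;; read_pi ;; positions ;; mask_strings ;;
     rename sub_reg sub_arr (party1 Q))
    (~~ first Q).

(* Main.v *)
Require Import Defs.
From mathcomp Require Import all_boot all_order all_algebra.
From mathcomp Require Import zify.
From Stdlib Require PeanoNat.

(* For a fixed mask pi', an execution of the protocol is an execution of the
   oblivious transfer on the strings pi' (+) y[pi (+) m], preceded by a silent
   computation of Bob: the messages are the same, with the parties exchanged.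
   Hence the costs. The distributions to be compared are averages over pi' of
   those of the oblivious transfer, up to a fixed transformation of the string
   given to the distinguisher: some bits are constants known from the inputs and
   pi', the others are shifted. Such a transformation is absorbed by the input
   gates of a circuit without changing its size. Alice is simulated by the
   simulator of the chooser; Bob by that of the sender, run on strings computed
   from (pi, y, pi'), after which the beginning of the view is replaced. *)

Set Implicit Arguments.
Unset Strict Implicit.
Unset Printing Implicit Defensive.

(** * Running machines *)

(** Each distribution pairs one party's view with the other's output, so pi' cannot be resampled on
    either side: it is Bob's whole output, uniform in both experiments, and everything is
    conditioned on it. Once pi' is fixed, the strings offered and the value of [Ind] are determined
    and only the coins of the oblivious transfer and of its simulator remain random. Its privacy
    holds for all inputs with a single threshold on the security parameter, so it may be applied to
    strings that depend on pi'.

    For fixed pi' the comparison of executions is an exact correspondence, coin by coin. Bob's tape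
    is read as pi', then the sender's coins, then a surplus. As an exhausted tape yields [false],
    the correspondence lasts only while the shorter tape does, hence the counter carried by all
    simulation relations. The other obstacle is the schedule: the chooser may speak first, so a
    message may reach Bob before he has begun, and his preparation has to be inserted in the middle
    of an execution. *)

Definition atomic (c : cmd) : bool :=
  match c with
  | Yield | Seq _ _ | Cond _ _ _ | While _ _ => false
  | _ => true
  end.

Definition effect (c : cmd) (m : memory) : memory := (tick ([:: c], m)).2.

(** Big-step semantics with an exact step count. No rule covers [Yield], so a derivation certifies
    that the command sends nothing and can be replayed by [tick] as well as by [jstep]. *)
Inductive exec : cmd -> memory -> nat -> memory -> Prop :=
| ExecAtomic c m : atomic c -> exec c m 1 (effect c m)
| ExecSeq c d m1 m2 m3 s t :
    exec c m1 s m2 -> exec d m2 t m3 -> exec (c ;; d) m1 (s + t).+1 m3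
| ExecCond x c d m1 m2 s :
    exec (if reg m1 x != 0 then c else d) m1 s m2 ->
    exec (Cond x c d) m1 s.+1 m2
| ExecStop x c m : reg m x = 0 -> exec (While x c) m 1 m
| ExecLoop x c m1 m2 m3 s t :
    reg m1 x != 0 -> exec c m1 s m2 -> exec (While x c) m2 t m3 ->
    exec (While x c) m1 (s + t).+1 m3.

Lemma exec_ticks c m s m' :
  exec c m s m' -> forall K, iter s tick (c :: K, m) = (K, m').
Proof.
elim=> {c m s m'}.
- by move=> [] //= *; rewrite /= /effect //=; case: ifP.
- move=> c d m1 m2 m3 s t _ IH1 _ IH2 K.
  by rewrite iterSr addnC iterD /= IH1 IH2.
- by move=> x c d m1 m2 s _ IH K; rewrite iterSr /= IH.
- by move=> x c m /= -> K.
- move=> x c m1 m2 m3 s t x0 _ IH1 _ IH2 K.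
  by rewrite iterSr addnC iterD /= x0 IH1 IH2.
Qed.

Definition active (c : conf) (i : bool) (K : seq cmd) (m : memory) (u : thread)
    (l : seq (bool * bitseq)) : Prop :=
  [/\ turn c = i, thr c i = (K, m), thr c (~~ i) = u & log c = l].

Lemma jstep_active c i k K m u l : active c i (k :: K) m u l ->
  k <> Yield ->
  active (jstep c) i (tick (k :: K, m)).1 (tick (k :: K, m)).2 u l.
Proof.
case: c => tn th lg [/= tni thi thn lgl] kY; rewrite /jstep /= tni thi.
case: k kY thi => //= *;
  by split; rewrite //= /upd ?eqxx -?surjective_pairing //; case: (i) thn.
Qed.

Lemma exec_jsteps k m s m' : exec k m s m' -> forall c i K u l,
  active c i (k :: K) m u l -> active (iter s jstep c) i K m' u l.
Proof.
elim=> {k m s m'}.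
- move=> k m at_k c i K u l ac /=.
  have kY : k <> Yield by move=> kE; rewrite kE in at_k.
  have := jstep_active ac kY.
  by case: k at_k ac {kY} => //= *; rewrite /effect //=; case: ifP.
- move=> k d m1 m2 m3 s t _ IH1 _ IH2 c i K u l ac.
  rewrite iterSr addnC iterD; apply/IH2/IH1.
  exact: (jstep_active ac).
- move=> x k d m1 m2 s _ IH c i K u l ac.
  rewrite iterSr; apply/IH.
  exact: (jstep_active ac).
- move=> x k m x0 c i K u l ac.
  by have /= := jstep_active ac; rewrite x0; apply.
- move=> x k m1 m2 m3 s t x0 _ IH1 _ IH2 c i K u l ac.
  rewrite iterSr addnC iterD; apply/IH2/IH1.
  by have /= := jstep_active ac; rewrite x0; apply.
Qed.

(** * Total correctness with a bound on the number of steps *)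

Definition wp (T : nat) (c : cmd) (m : memory) (Q : memory -> Prop) : Prop :=
  exists s m', [/\ s <= T, exec c m s m' & Q m'].

Lemma wp_conseq T T' c m (Q Q' : memory -> Prop) :
  wp T c m Q -> T <= T' -> (forall m', Q m' -> Q' m') -> wp T' c m Q'.
Proof.
move=> [s [m' [sT ex Qm']]] TT QQ.
by exists s, m'; split; [exact: leq_trans sT TT | | exact: QQ].
Qed.

Lemma wp_atomic c m (Q : memory -> Prop) :
  atomic c -> Q (effect c m) -> wp 1 c m Q.
Proof. by move=> at_c Qm; exists 1, (effect c m); split=> //; apply: ExecAtomic. Qed.

Lemma wp_seq T1 T2 c d m (Q : memory -> Prop) :
  wp T1 c m (fun m' => wp T2 d m' Q) -> wp (T1 + T2).+1 (c ;; d) m Q.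
Proof.
move=> [s [m1 [sT ex [t [m2 [tT ex2 Qm]]]]]].
exists (s + t).+1, m2; split=> //; first by rewrite ltnS leq_add.
exact: ExecSeq ex ex2.
Qed.

Lemma wp_cond T x c d m (Q : memory -> Prop) :
  wp T (if reg m x != 0 then c else d) m Q -> wp T.+1 (Cond x c d) m Q.
Proof.
move=> [s [m1 [sT ex Qm]]]; exists s.+1, m1; split=> //.
exact: ExecCond.
Qed.

(** Each iteration adds 7 steps to the body: the loop test, three assignments and three sequencings.
    The remaining 5 are the two initialisations, their sequencings and the last test. The invariant
    must not depend on the counter or the scratch register; the value of the counter is tracked
    separately. *)
Lemma wp_for (i n t : nat) c N T (I : nat -> memory -> Prop) m :
  i != n -> t != n -> i != t ->
  (forall k m, I k m -> reg m n = N) ->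
  (forall k m v, I k m -> I k (set_reg m i v)) ->
  (forall k m v, I k m -> I k (set_reg m t v)) ->
  (forall k m, k < N -> reg m i = k -> I k m ->
     wp T c m (fun m' => reg m' i = k /\ I k.+1 m')) ->
  I 0 m -> wp (N * (T + 7) + 5) (For i n t c) m (I N).
Proof.
move=> ni nt ti In Ii It Ic I0.
set body := c ;; Const t 1 ;; Plus i i t ;; Minus t n i.
have loop k m1 : k <= N -> reg m1 i = k -> reg m1 t = N - k -> I k m1 ->
    wp ((N - k) * (T + 7) + 1) (While t body) m1 (I N).
  move eqd: (N - k) => d; elim: d k m1 eqd => [|d IH] k m1 eqd kN ik tk Ik.
    exists 1, m1; split; [by [] | by apply: ExecStop; rewrite tk |].
    by have <-: k = N by lia.
  have kN' : k < N by lia.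
  have [s [m2 [sT ex [i2 Ik2]]]] := Ic k m1 kN' ik Ik.
  pose m3 := effect (Minus t n i) (effect (Plus i i t) (effect (Const t 1) m2)).
  have ti' : (t == i) = false by rewrite eq_sym (negbTE ti).
  have ni' : (n == i) = false by rewrite eq_sym (negbTE ni).
  have nt' : (n == t) = false by rewrite eq_sym (negbTE nt).
  have i3 : reg m3 i = k.+1.
    rewrite /m3 /effect /= /upd !eqxx (negbTE ti) /= i2; lia.
  have n2 := In _ _ Ik2.
  have t3 : reg m3 t = d.
    by rewrite /m3 /effect /= /upd !eqxx (negbTE ti) ni' nt' /= i2 n2; lia.
  have I3 : I k.+1 m3 by apply/It/Ii/It.
  have [|s' [m4 [sT' ex' I4]]] := IH k.+1 m3 _ kN' i3 t3 I3; first lia.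
  have exb : exec body m1 (s + 6) m3.
    have -> : s + 6 = (s + (1 + (1 + 1).+1).+1).+1 by lia.
    by apply: (ExecSeq ex); do 2![apply: ExecSeq; first exact: ExecAtomic];
       apply: ExecAtomic.
  exists (s + 6 + s').+1, m4; split=> //; first lia.
  by apply: (ExecLoop _ exb ex'); rewrite tk.
have -> : N * (T + 7) + 5 = (1 + (1 + (N * (T + 7) + 1)).+1).+1 by lia.
apply/wp_seq/wp_atomic => //; apply/wp_seq/wp_atomic => //.
rewrite -[in N * _](subn0 N); apply: loop => //.
- by rewrite /effect /= /upd ?eqxx (negbTE ti) ?eqxx.
- rewrite /effect /= /upd !eqxx (negbTE (_ : n != i)) 1?eq_sym //.
  by rewrite (In _ _ I0).
- exact/It/Ii.
Qed.

(* [n] is the number of steps for which the tape of [t1] is sure to suffice: on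
   an empty tape a toss yields [false], whatever the longer tape of [t2]. *)
Record renames (fr fa : nat -> nat) (K0 : seq cmd) (R0 : nat -> nat)
    (A0 : nat -> seq nat) (pre : bitseq) (n : nat) (t1 t2 : thread) : Prop :=
  Renames {
    rn_stack : t2.1 = [seq rename fr fa c | c <- t1.1] ++ K0;
    rn_reg : forall x, reg t2.2 (fr x) = reg t1.2 x;
    rn_arr : forall a, arr t2.2 (fa a) = arr t1.2 a;
    rn_reg0 : forall x, (forall y, x != fr y) -> reg t2.2 x = R0 x;
    rn_arr0 : forall a, (forall b, a != fa b) -> arr t2.2 a = A0 a;
    rn_tape : exists e, tape t2.2 = tape t1.2 ++ e;
    rn_size : n <= size (tape t1.2);
    rn_tossed : tossed t2.2 = pre ++ tossed t1.2
  }.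

Section Renaming.

Variables (fr fa : nat -> nat) (K0 : seq cmd).
Hypotheses (fr_inj : injective fr) (fa_inj : injective fa).
Variables (R0 : nat -> nat) (A0 : nat -> seq nat) (pre : bitseq).
Let rn := renames fr fa K0 R0 A0 pre.

Lemma renames_le n n' t1 t2 : n' <= n -> rn n t1 t2 -> rn n' t1 t2.
Proof. by move=> le [*]; split=> //; apply: leq_trans le _. Qed.

Lemma renames_set_reg n K1 m1 K2 m2 x v :
  rn n (K1, m1) (K2, m2) ->
  rn n (K1, set_reg m1 x v) (K2, set_reg m2 (fr x) v).
Proof.
move=> [/= st rg ar rg0 ar0 tp sz ts]; split=> //= y.
- by rewrite /upd (inj_eq fr_inj); case: ifP.
- by move=> yP; rewrite /upd (negbTE (yP x)) rg0.
Qed.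

Lemma renames_set_arr n K1 m1 K2 m2 x v :
  rn n (K1, m1) (K2, m2) ->
  rn n (K1, set_arr m1 x v) (K2, set_arr m2 (fa x) v).
Proof.
move=> [/= st rg ar rg0 ar0 tp sz ts]; split=> //= y.
- by rewrite /upd (inj_eq fa_inj); case: ifP.
- by move=> yP; rewrite /upd (negbTE (yP x)) ar0.
Qed.

Lemma renames_tick n t1 t2 : ~~ halted t1 ->
  rn n.+1 t1 t2 -> rn n (tick t1) (tick t2).
Proof.
case: t1 t2 => [[|c K1] m1] [K2 m2] //= _ rnt.
have st := rn_stack rnt; rewrite /= in st.
have rg := rn_reg rnt; have ar := rn_arr rnt; rewrite /= in rg ar.
have base : rn n (K1, m1) ([seq rename fr fa c | c <- K1] ++ K0, m2).
  case: rnt => /= *; split=> //; exact: ltnW.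
rewrite {}st /=.
case: c rnt => [|x k|x y z|x y z|x y z|x a|x a i|a i x|a x|x||c d|x c d|x c] rnt /=.
- exact: base.
- exact: renames_set_reg.
- by rewrite !rg; apply: renames_set_reg.
- by rewrite !rg; apply: renames_set_reg.
- by rewrite !rg; apply: renames_set_reg.
- by rewrite !ar; apply: renames_set_reg.
- by rewrite !ar !rg; apply: renames_set_reg.
- rewrite !ar !rg; case: ifP => _; [exact: renames_set_arr | exact: base].
- by rewrite !ar !rg; apply: renames_set_arr.
(* A toss: the reserve [n.+1] makes the tape of [t1] nonempty, so both threads read the same bit. *)
- case: rnt => /= _ _ _ _ _ [e te] sz _.
  case: base => /= _ _ _ rg0 ar0 _ _ ts.
  rewrite /toss te; case tE: (tape m1) sz => [|b tp] //= sz.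
  split=> //=.
  + by move=> y; rewrite /upd (inj_eq fr_inj); case: ifP.
  + by move=> y yP; rewrite /upd (negbTE (yP x)) rg0.
  + by exists e.
  + by rewrite ts rcons_cat.
- exact: base.
- case: base => /= *; by split.
- case: base => /= *; split=> //=; by rewrite rg; case: ifP.
- case: base => /= *; split=> //=; by rewrite rg; case: ifP.
Qed.

(** The renamed thread is stopped as soon as the original one has halted, hence [s <= n]: further
    steps would run into the caller's continuation [K0]. *)
Lemma renames_run n t1 t2 : rn n t1 t2 -> halted (iter n tick t1) ->
  exists2 s, s <= n & rn 0 (iter n tick t1) (iter s tick t2).
Proof.
elim: n t1 t2 => [|n IH] t1 t2 rnt.
  by move=> _; exists 0.
have [ht|ht] := boolP (halted t1).
  move=> _; exists 0 => //.
  suff -> : iter n.+1 tick t1 = t1 by apply: renames_le rnt.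
  elim: n.+1 => //= k ->; by case: t1 ht {rnt} => [[|//]].
rewrite iterSr => h.
have [s sn rns] := IH _ _ (renames_tick ht rnt) h.
by exists s.+1; rewrite // iterSr.
Qed.

End Renaming.

(** * Bob's preparation *)

(** Strings are read least significant bit first, so this is the induction step that identifies the
    exclusive or of numbers with that of strings. *)
Lemma lxor_double_add (a b : bool) (m n : nat) :
  Nat.lxor (a + 2 * m) (b + 2 * n) = (a (+) b) + 2 * Nat.lxor m n.
Proof.
have tb (c : bool) k i : Nat.testbit (c + 2 * k) i =
    if i is j.+1 then Nat.testbit k j else c.
  have -> : c + 2 * k = (2 * k + PeanoNat.Nat.b2n c)%coq_nat by case: c; rewrite /=; lia.
  by case: i => [|i]; [exact: PeanoNat.Nat.testbit_0_r |
    exact: PeanoNat.Nat.testbit_succ_r].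
apply: PeanoNat.Nat.bits_inj => i.
rewrite PeanoNat.Nat.lxor_spec !tb; case: i => [|i].
  by case: a b => [] [].
exact/esym/PeanoNat.Nat.lxor_spec.
Qed.

Lemma lxor_bool (a b : bool) : Nat.lxor a b = a (+) b :> nat.
Proof. by case: a b => [] []. Qed.

Lemma lxor_lt l m n : m < 2 ^ l -> n < 2 ^ l -> Nat.lxor m n < 2 ^ l.
Proof.
elim: l m n => [|l IH] m n; first by rewrite !ltnS !leqn0 => /eqP-> /eqP->.
rewrite -[m]odd_double_half -[n]odd_double_half -!mul2n !expnS => ml nl.
have {IH} : Nat.lxor m./2 n./2 < 2 ^ l by apply: IH; lia.
by rewrite lxor_double_add; case: (odd m (+) odd n) => /=; lia.
Qed.

Lemma string_value_cons l b (s : l.-tuple bool) :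
  string_value (cons_tuple b s) = b + 2 * string_value s.
Proof.
rewrite /string_value big_ord_recl tnth0 muln1.
congr (_ + _); rewrite big_distrr /=; apply: eq_bigr => i _.
by rewrite tnthS /bump /= add1n expnS mulnCA.
Qed.

Lemma tnth_xort n (a b : n.-tuple bool) i :
  tnth (xort a b) i = tnth a i (+) tnth b i.
Proof. by rewrite tnth_mktuple. Qed.

Lemma string_value_xort l (s t : l.-tuple bool) :
  string_value (xort s t) = Nat.lxor (string_value s) (string_value t).
Proof.
elim: l s t => [|l IH] s t; first by rewrite /string_value !big_ord0.
case/tupleP: s => a s; case/tupleP: t => b t.
rewrite !string_value_cons lxor_double_add -IH -string_value_cons.
congr string_value; apply: eq_from_tnth => i; rewrite tnth_xort.
by case: (unliftP ord0 i) => [j|] ->; rewrite ?tnth0 // !tnthS tnth_xort.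
Qed.

Lemma size_cells s : size (cells s) = size s.
Proof. exact: size_map. Qed.

Lemma cells_cat s t : cells (s ++ t) = cells s ++ cells t.
Proof. exact: map_cat. Qed.

Lemma cells_rcons s b : cells (rcons s b) = rcons (cells s) (nat_of_bool b).
Proof. exact: map_rcons. Qed.

Lemma nth_cells s i : nth 0 (cells s) i = nth false s i.
Proof.
have [lt|ge] := ltnP i (size s); first by rewrite (nth_map false).
by rewrite !nth_default // size_cells.
Qed.

Lemma bits_cells s : bits (cells s) = s.
Proof. by rewrite /bits /cells -map_comp map_id_in // => -[]. Qed.

Definition masked_index p (pi : (logw p).-tuple bool) (m : 'I_(width p)) :
  'I_(width p) := Ordinal (lxor_lt (string_value_lt pi) (ltn_ord m)).

Definition offered p (pi : (logw p).-tuple bool) (mask : (len p).-tuple bool)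
    (y : strings p) : strings p :=
  [tuple xort mask (tnth y (masked_index pi m)) | m < width p].

(** Correctness of the protocol: what a chooser with index [J] obtains is Alice's output in
    [Ind]. *)
Lemma tnth_offered p (pi J : (logw p).-tuple bool) mask (y : strings p) :
  tnth (offered pi mask y) (string_index J) =
  xort mask (tnth y (string_index (xort pi J))).
Proof.
rewrite tnth_mktuple; congr (xort mask (tnth y _)); apply: val_inj.
by rewrite /= string_value_xort.
Qed.

Lemma offered_zero p (y : strings p) :
  offered [tuple of nseq (logw p) false] [tuple of nseq (len p) false] y = y.
Proof.
have v0 : string_value [tuple of nseq (logw p) false] = 0.
  by rewrite /string_value big1 // => i _; rewrite (tnth_nth false) nth_nseq if_same.
apply: eq_from_tnth => m; rewrite tnth_mktuple.
have -> : masked_index [tuple of nseq (logw p) false] m = m.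
  by apply: val_inj; rewrite /= v0 PeanoNat.Nat.lxor_0_l.
apply: eq_from_tnth => i; rewrite tnth_xort (tnth_nth false) /= nth_nseq.
by rewrite if_same.
Qed.

Lemma size_code_strings p (y : strings p) :
  size (code_strings y) = width p * len p.
Proof.
rewrite /code_strings size_flatten /shape -map_comp -[in RHS](size_tuple y).
by elim: (val y) => //= s ss ->; rewrite size_tuple mulSn.
Qed.

Lemma nth_flatten_same (n : nat) (ss : seq bitseq) i j :
  all (fun s => size s == n) ss -> j < n ->
  nth false (flatten ss) (i * n + j) = nth false (nth [::] ss i) j.
Proof.
move=> + jn; elim: ss i => [|s ss IH] i /=; first by rewrite !nth_nil.
case/andP=> /eqP sn ssn; rewrite nth_cat sn; case: i => [|i] /=.
  by rewrite mul0n add0n jn.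
by rewrite mulSn -addnA ltnNge leq_addr /= addKn IH.
Qed.

Lemma nth_code_strings p (y : strings p) (i : 'I_(width p)) (j : 'I_(len p)) :
  nth false (code_strings y) (i * len p + j) = tnth (tnth y i) j.
Proof.
rewrite /code_strings nth_flatten_same //; last first.
  by apply/allP => s /mapP [t _ ->]; rewrite size_tuple.
have iy : i < size y by rewrite size_tuple.
rewrite (nth_map [tuple of nseq (len p) false]) // -tnth_nth.
by rewrite -tnth_nth.
Qed.

(** * Frame conditions and the loops of Bob's preparation *)

Record same (X Y : seq nat) (m m' : memory) : Prop := Same {
  same_reg : forall x, x \notin X -> reg m' x = reg m x;
  same_arr : forall a, a \notin Y -> arr m' a = arr m a;
  same_tape : tape m' = tape m;
  same_tossed : tossed m' = tossed m
}.

Lemma same_refl X Y m : same X Y m m.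
Proof. by []. Qed.

Lemma same_set_reg (X Y : seq nat) m m' x v :
  x \in X -> same X Y m m' -> same X Y m (set_reg m' x v).
Proof.
move=> xX [rg ar tp ts]; split=> // z zX; rewrite -rg //= /upd.
by case: eqP => // zx; rewrite zx xX in zX.
Qed.

Lemma same_set_arr (X Y : seq nat) m m' x v :
  x \in Y -> same X Y m m' -> same X Y m (set_arr m' x v).
Proof.
move=> xY [rg ar tp ts]; split=> // z zY; rewrite -ar //= /upd.
by case: eqP => // zx; rewrite zx xY in zY.
Qed.

Lemma same_toss (X Y : seq nat) rg ar tp ts m x k :
  x \in X -> k < size tp ->
  same X Y (Memory rg ar (drop k tp) (ts ++ take k tp)) m ->
  same X Y (Memory rg ar (drop k.+1 tp) (ts ++ take k.+1 tp)) (toss m x).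
Proof.
move=> xX lt_k [/= sr sa st ss]; split=> //=.
- move=> z zX; rewrite -sr //= /upd.
  by case: eqP => // zx; rewrite zx xX in zX.
- by rewrite st (drop_nth false).
- by rewrite ss st (take_nth false) // (drop_nth false lt_k) rcons_cat.
Qed.

Lemma same_trans (X Y X' Y' : seq nat) m1 m2 m3 :
  same X Y m1 m2 -> same X' Y' m2 m3 -> same (X ++ X') (Y ++ Y') m1 m3.
Proof.
move=> [rg ar tp ts] [rg' ar' tp' ts']; split; rewrite ?tp' ?ts' //.
- by move=> x; rewrite mem_cat negb_or => /andP[xX xX']; rewrite rg' ?rg.
- by move=> x; rewrite mem_cat negb_or => /andP[xX xX']; rewrite ar' ?ar.
Qed.

Lemma same_sub (X Y X' Y' : seq nat) m m' :
  {subset X <= X'} -> {subset Y <= Y'} -> same X Y m m' -> same X' Y' m m'.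
Proof.
move=> sX sY [rg ar tp ts]; split=> // x xP.
- by apply: rg; apply: contra xP; apply: sX.
- by apply: ar; apply: contra xP; apply: sY.
Qed.

(** The step count is left as an unknown that [wp_step] builds up along the program; comparing it
    with the stated bound is a separate arithmetic goal. *)
Ltac wp_start := refine (@wp_conseq _ _ _ _ _ _ _ _ (fun _ h => h)).
Tactic Notation "wp_use" uconstr(H) := refine (wp_conseq H (leqnn _) _).
Ltac wp_step :=
  lazymatch goal with
  | |- wp _ (_ ;; _) _ _ => eapply wp_seq
  | |- wp _ (Cond _ _ _) _ _ => eapply wp_cond
  | |- wp _ _ _ _ => eapply wp_atomic; [exact isT|]
  end.
Ltac same_tac :=
  rewrite ?/effect; cbn [tick snd];
  repeat first [ apply: same_set_reg; [exact: isT|]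
               | apply: same_set_arr; [exact: isT|] ];
  try exact: same_refl.

(** [same] does not allow coins to change, so the loop is compared with a memory in which its [n]
    tosses have already been made. *)
Lemma choose_mask_spec m n :
  reg m rLen = n -> arr m aOut = [::] -> n <= size (tape m) ->
  wp (n * 10 + 5) choose_mask m (fun m' =>
    same [:: rI; rT; rB] [:: aOut]
      (Memory (reg m) (arr m) (drop n (tape m)) (tossed m ++ take n (tape m))) m'
    /\ arr m' aOut = cells (take n (tape m))).
Proof.
move=> rl oe szn.
pose I k m' := 
    same [:: rI; rT; rB] [:: aOut]
      (Memory (reg m) (arr m) (drop k (tape m)) (tossed m ++ take k (tape m))) m'
    /\ arr m' aOut = cells (take k (tape m)).
apply: (wp_for (N := n) (T := 3) (I := I)) => //.
- by move=> k m1 [sm _]; rewrite (same_reg sm).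
- by move=> k m1 v [sm am]; split=> //; apply: same_set_reg.
- by move=> k m1 v [sm am]; split=> //; apply: same_set_reg.
- move=> k m1 kn ik [sm am].
  have kt : k < size (tape m) by apply: leq_trans kn szn.
  wp_start; first do 3 wp_step; last by [].
  split=> //; split; first by same_tac; apply: same_toss.
  rewrite /effect /= /upd /= am (take_nth false kt) cells_rcons (same_tape sm) /=.
  by rewrite (drop_nth false kt).
- split; last by rewrite take0.
  by split; rewrite /= ?drop0 ?take0 ?cats0.
Qed.

Lemma read_pi_spec m l (pi : l.-tuple bool) rest :
  reg m rLogW = l -> arr m aIn = cells pi ++ rest ->
  wp (l * 13 + 9) read_pi m (fun m' =>
    same [:: rPi; rPow; rI; rT; rB] [::] m m' /\ reg m' rPi = string_value pi).
Proof.
move=> rl ai.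
pose I k m' := [/\ same [:: rPi; rPow; rI; rT; rB] [::] m m',
  reg m' rPi = \sum_(0 <= b < k) nth false pi b * 2 ^ b & reg m' rPow = 2 ^ k].
suff loop m1 : I 0 m1 -> wp (l * (6 + 7) + 5)
    (For rI rLogW rT (Get rB aIn rI ;; Cond rB (Plus rPi rPi rPow) Skip ;;
       Plus rPow rPow rPow)) m1 (I l).
  rewrite /read_pi; wp_start.
    do 4 wp_step; wp_use (loop _ _); last first.
      move=> m' [sm pm _]; split=> //; rewrite pm /string_value big_mkord.
      by apply: eq_bigr => b _; rewrite (tnth_nth false).
    by split; [same_tac | rewrite big_geq |].
  by lia.
move=> I0; apply: (wp_for (I := I)) => //.
- by move=> k m2 [sm _ _]; rewrite (same_reg sm).
- by move=> k m2 v [sm am pm]; split=> //; apply: same_set_reg.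
- by move=> k m2 v [sm am pm]; split=> //; apply: same_set_reg.
move=> k m2 kl ik [sm am pm].
have bk : nth 0 (arr m2 aIn) k = nth false pi k.
  rewrite (same_arr sm) // ai nth_cat size_cells size_tuple kl.
  exact: nth_cells.
wp_start; first do 4 wp_step.
  rewrite {1}/effect /= {1}/upd /= ik bk.
  rewrite (_ : (if _ then _ else _) =
    if nth false pi k then Plus rPi rPi rPow else Skip); last by case: nth.
  rewrite /I big_nat_recr //= expnS.
  by case: (nth false pi k); do 2 wp_step; split=> //; split; try same_tac;
    rewrite /effect /= /upd /= ?am ?pm; try lia.
by [].
Qed.

Lemma positions_spec m l n w :
  reg m rLogW = l -> reg m rLen = n -> reg m rW = w -> arr m aPos = [::] ->
  wp (w * 10 + 9) positions m (fun m' =>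
    [/\ same [:: rPos; rI; rT] [:: aPos] m m', reg m' rPos = l + w * n &
     arr m' aPos = mkseq (fun i => l + i * n) w]).
Proof.
move=> rl rn rw ap.
pose I k m' := [/\ same [:: rPos; rI; rT] [:: aPos] m m',
  reg m' rPos = l + k * n & arr m' aPos = mkseq (fun i => l + i * n) k].
suff loop m1 : I 0 m1 -> wp (w * (3 + 7) + 5)
    (For rI rW rT (Push aPos rPos ;; Plus rPos rPos rLen)) m1 (I w).
  rewrite /positions; wp_start.
    do 4 wp_step; wp_use (loop _ _) => //.
    by split; [same_tac | rewrite /effect /= /upd /= rl; lia |].
  by lia.
move=> I0; apply: (wp_for (I := I)) => //.
- by move=> k m2 [sm _ _]; rewrite (same_reg sm).
- by move=> k m2 v [sm am pm]; split=> //; apply: same_set_reg.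
- by move=> k m2 v [sm am pm]; split=> //; apply: same_set_reg.
move=> k m2 kl ik [sm am pm].
wp_start; first do 3 wp_step; last by [].
split=> //; split; first same_tac => //.
  by rewrite /effect /= /upd /= am (same_reg sm) // rn; lia.
by rewrite /effect /= /upd /= am pm mkseqS.
Qed.

(** The array of the mask is a parameter because Bob reads pi' from his output array, whereas his
    simulator needs that array for the view it writes. *)
Definition mask_strings_with (aMask : nat) : cmd :=
  For rI rW rT
    (Xor rPos rPi rI ;; Get rPos aPos rPos ;;
     For rJ rLen rU
       (Get rB aIn rPos ;; Get rC aMask rJ ;; Xor rB rC rB ;;
        Push (sub_arr aIn) rB ;; Const rC 1 ;; Plus rPos rPos rC)).

Lemma mask_string_spec aMask m n (s mask : n.-tuple bool) q out :
  aMask != sub_arr aIn -> reg m rLen = n -> reg m rPos = q ->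
  (forall j : 'I_n, nth 0 (arr m aIn) (q + j) = tnth s j) ->
  arr m aMask = cells mask -> arr m (sub_arr aIn) = cells out ->
  wp (n * 18 + 5)
    (For rJ rLen rU
       (Get rB aIn rPos ;; Get rC aMask rJ ;; Xor rB rC rB ;;
        Push (sub_arr aIn) rB ;; Const rC 1 ;; Plus rPos rPos rC)) m
    (fun m' => same [:: rJ; rU; rB; rC; rPos] [:: sub_arr aIn] m m' /\
       arr m' (sub_arr aIn) = cells (out ++ xort mask s)).
Proof.
move=> aM rn rq ain amk ao; move: (xort mask s) (tnth_xort mask s) => u uE.
pose I k m' := [/\ same [:: rJ; rU; rB; rC; rPos] [:: sub_arr aIn] m m',
  arr m' (sub_arr aIn) = cells (out ++ take k u) &
  reg m' rPos = q + k].
suff loop : wp (n * (11 + 7) + 5) (For rJ rLen rU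
       (Get rB aIn rPos ;; Get rC aMask rJ ;; Xor rB rC rB ;;
        Push (sub_arr aIn) rB ;; Const rC 1 ;; Plus rPos rPos rC)) m (I n).
  by wp_use loop => m' [sm am _]; rewrite take_oversize ?size_tuple in am.
apply: (wp_for (I := I)) => //.
- by move=> k m2 [sm _ _]; rewrite (same_reg sm).
- by move=> k m2 v [sm am pm]; split=> //; apply: same_set_reg.
- by move=> k m2 v [sm am pm]; split=> //; apply: same_set_reg.
- move=> k m2 kl ik [sm am pm].
  wp_start; first do 11 wp_step; last by [].
  split=> //; split; first same_tac => //.
    rewrite /effect; cbn [tick snd set_reg set_arr reg arr]; rewrite /upd /=.
    rewrite am pm ik !(same_arr sm) ?inE //.
    rewrite (ain (Ordinal kl)) amk nth_cells (take_nth false) ?size_tuple //.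
    rewrite -rcons_cat cells_rcons lxor_bool; congr rcons.
    have nthE (t : n.-tuple bool) : nth false t k = tnth t (Ordinal kl).
      by rewrite (tnth_nth false).
    by rewrite !nthE uE.
  by rewrite /effect /= /upd /= pm addn1 addnS.
- by split; rewrite ?take0 ?cats0 ?addn0.
Qed.

Lemma mask_strings_spec p (pi : (logw p).-tuple bool) (y : strings p)
    (mask : (len p).-tuple bool) aMask m rest :
  aMask != sub_arr aIn -> reg m rW = width p -> reg m rLen = len p ->
  reg m rPi = string_value pi ->
  arr m aPos = mkseq (fun i => logw p + i * len p) (width p) ->
  arr m aIn = cells (pi ++ code_strings y) ++ rest ->
  arr m aMask = cells mask -> arr m (sub_arr aIn) = [::] ->
  wp (width p * (len p * 18 + 16) + 5) (mask_strings_with aMask) m (fun m' =>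
    same [:: rI; rT; rPos; rJ; rU; rB; rC] [:: sub_arr aIn] m m' /\
    arr m' (sub_arr aIn) = cells (code_strings (offered pi mask y))).
Proof.
move=> aM rw rn rp ap ain amk ao.
pose I k m' := same [:: rI; rT; rPos; rJ; rU; rB; rC] [:: sub_arr aIn] m m' /\
  arr m' (sub_arr aIn) =
    cells (flatten (take k [seq tval s | s <- offered pi mask y])).
suff loop : wp (width p * (len p * 18 + 9 + 7) + 5)
    (mask_strings_with aMask) m (I (width p)).
  apply: wp_conseq loop _ _ => [|m' [sm am]]; first by rewrite -addnA.
  by split=> //; rewrite am take_oversize // size_map size_tuple.
apply: (wp_for (I := I)) => //.
- by move=> k m2 [sm _]; rewrite (same_reg sm).
- by move=> k m2 v [sm am]; split=> //; apply: same_set_reg.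
- by move=> k m2 v [sm am]; split=> //; apply: same_set_reg.
- move=> k m2 kw ik [sm am].
  pose i := masked_index pi (Ordinal kw).
  wp_start; first do 4 wp_step.
    set m3 := effect _ _.
    have sm3 : same [:: rPos] [::] m2 m3 by rewrite /m3; same_tac.
    have q3 : reg m3 rPos = logw p + i * len p.
      rewrite /m3 /effect /= /upd /= ik (same_arr sm) // ap (same_reg sm) // rp.
      by rewrite nth_mkseq // (ltn_ord i).
    wp_use (mask_string_spec (s := tnth y i) (mask := mask) aM _ q3 _ _ _).
    + by rewrite (same_reg sm3) // (same_reg sm).
    + move=> j; rewrite (same_arr sm3) // (same_arr sm) // ain.
      rewrite nth_cat size_cells size_cat size_tuple size_code_strings -addnA.
      rewrite ltn_add2l (_ : _ < _) ?nth_cells ?nth_cat ?size_tuple; last first.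
        have := ltn_ord i; have := ltn_ord j; nia.
      rewrite ltnNge leq_addr /= addKn.
      exact/(congr1 nat_of_bool)/(nth_code_strings y i j).
    + by rewrite (same_arr sm3) // (same_arr sm) // inE.
    + by rewrite (same_arr sm3) //; exact: am.
    + move=> m' [sm' am']; split.
        by rewrite (same_reg sm') // (same_reg sm3).
      split.
        by apply: same_sub (same_trans (same_trans sm sm3) sm'); apply/allP.
      rewrite am' (take_nth [::]); last by rewrite size_map size_tuple.
      rewrite flatten_rcons.
      congr (cells (_ ++ _)).
      rewrite (nth_map [tuple of nseq (len p) false]); last by rewrite size_tuple.
      have -> : nth [tuple of nseq (len p) false] (offered pi mask y) k =
          tnth (offered pi mask y) (Ordinal kw)
        by rewrite (tnth_nth [tuple of nseq (len p) false]).
      by rewrite tnth_mktuple.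
  by rewrite /=; lia.
- by split; rewrite ?take0.
Qed.

(** The code [c'] that is reached may send messages, which [exec] cannot describe, so only the
    silent part before it is run. The behaviour of a thread alone serves for the simulator, that
    inside a joint execution for Bob. *)
Definition leads (T : nat) (c : cmd) (m : memory) (c' : cmd)
    (Q : memory -> Prop) : Prop :=
  exists s m', [/\ s <= T, Q m',
    forall K, iter s tick (c :: K, m) = (c' :: K, m') &
    forall cf i K u l, active cf i (c :: K) m u l ->
      active (iter s jstep cf) i (c' :: K) m' u l].

Lemma leads_refl c m (Q : memory -> Prop) : Q m -> leads 0 c m c Q.
Proof. by exists 0, m. Qed.

Lemma leads_seq T1 T2 c d c' m (Q : memory -> Prop) :
  wp T1 c m (fun m' => leads T2 d m' c' Q) -> leads (T1 + T2).+1 (c ;; d) m c' Q.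
Proof.
move=> [s1 [m1 [s1T ex [s2 [m2 [s2T Qm tk js]]]]]].
exists (s1 + s2).+1, m2; split=> //; first by rewrite ltnS leq_add.
- by move=> K; rewrite iterSr addnC iterD /= (exec_ticks ex) tk.
- move=> cf i K u l ac; rewrite iterSr addnC iterD.
  by apply/js/(exec_jsteps ex)/(jstep_active ac).
Qed.

Lemma leads_conseq T T' c c' m (Q Q' : memory -> Prop) :
  leads T c m c' Q -> T <= T' -> (forall m', Q m' -> Q' m') ->
  leads T' c m c' Q'.
Proof.
move=> [s [m' [sT Qm tk js]]] TT QQ; exists s, m'; split=> //.
- exact: leq_trans sT TT.
- exact: QQ.
Qed.

Ltac leads_start := refine (@leads_conseq _ _ _ _ _ _ _ _ _ (fun _ h => h)).

(* The memory of a party before it has acted, apart from its inbox. *)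
Record fresh (p : param) (z r : bitseq) (m : memory) : Prop := Fresh {
  fresh_reg : reg m =1 nth 0 [:: width p; logw p; sec p; len p];
  fresh_in : arr m aIn = cells z;
  fresh_arr : forall a, a \notin [:: aIn; aInbox] -> arr m a = [::];
  fresh_tape : tape m = r;
  fresh_tossed : tossed m = [::]
}.

Lemma fresh_load p z r : fresh p z r (load p z r).
Proof. by split=> // -[]. Qed.

Lemma fresh_inbox p z r m s : fresh p z r m -> fresh p z r (set_arr m aInbox s).
Proof.
case=> rg ain ar tp ts; split=> // a aP; rewrite -(ar a aP) /= /upd.
by rewrite !inE negb_or in aP; case/andP: aP => _ /negbTE ->.
Qed.

(** Up to constants, the four loops cost [len p], [logw p], [width p] and [width p * len p]. Since
    [logw p < width p] and [0 < len p], all are absorbed by the last, which linearity of the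
    oblivious transfer compares with its work; 120 leaves some slack. *)
Definition mask_time (p : param) : nat := 120 * (width p * len p).

Lemma width_gt0 p : 0 < width p. Proof. by rewrite expn_gt0. Qed.

Lemma logw_lt_width p : logw p < width p. Proof. exact: ltn_expl. Qed.

Lemma mask_leads Q p (pi : (logw p).-tuple bool) (y : strings p)
    (mask : (len p).-tuple bool) r m :
  fresh p (pi ++ code_strings y) (mask ++ r) m ->
  leads (mask_time p) (party2 (P_Ind Q)) m (rename sub_reg sub_arr (party1 Q))
    (fun m' => same [:: rI; rT; rJ; rU; rB; rC; rPi; rPow; rPos]
       [:: aOut; aPos; sub_arr aIn] (Memory (reg m) (arr m) r mask) m' /\
     arr m' aOut = cells mask /\
     arr m' (sub_arr aIn) = cells (code_strings (offered pi mask y))).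
Proof.
move=> [rg ain ar tp ts]; rewrite /P_Ind /=.
have tmask : take (len p) (mask ++ r) = mask.
  by rewrite take_size_cat ?size_tuple.
have dmask : drop (len p) (mask ++ r) = r.
  by rewrite drop_size_cat ?size_tuple.
leads_start.
  apply: leads_seq.
  wp_use (choose_mask_spec (n := len p) _ _ _) => [|||m1 [sm1 o1]].
  - by rewrite rg.
  - by rewrite ar.
  - by rewrite tp size_cat size_tuple leq_addr.
  rewrite tp ts tmask dmask /= in sm1 o1.
  apply: leads_seq.
  wp_use (read_pi_spec (pi := pi) (rest := cells (code_strings y)) _ _)
    => [||m2 [sm2 pi2]].
  - by rewrite (same_reg sm1) //= rg.
  - by rewrite (same_arr sm1) //= ain cells_cat.
  have o2 : arr m2 aOut = cells mask by rewrite (same_arr sm2).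
  have {}sm2 := same_trans sm1 sm2.
  apply: leads_seq.
  wp_use (positions_spec (l := logw p) (n := len p) (w := width p) _ _ _ _)
    => [||||m3 [sm3 _ pos3]].
  - by rewrite (same_reg sm2) //= rg.
  - by rewrite (same_reg sm2) //= rg.
  - by rewrite (same_reg sm2) //= rg.
  - by rewrite (same_arr sm2) //= ar.
  have pi3 : reg m3 rPi = string_value pi by rewrite (same_reg sm3).
  have o3 : arr m3 aOut = cells mask.
    by rewrite (same_arr sm3).
  have {}sm3 := same_trans sm2 sm3.
  apply: leads_seq.
  wp_use (@mask_strings_spec p pi y mask aOut m3 [::] _ _ _ _ _ _ _ _)
    => [||||||||m4 [sm4 x4]] //.
  - by rewrite (same_reg sm3) //= rg.
  - by rewrite (same_reg sm3) //= rg.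
  - by rewrite cats0 (same_arr sm3) //=.
  - by rewrite (same_arr sm3) //= ar.
  apply: leads_refl; split; last first.
    by split=> //; rewrite (same_arr sm4).
  by apply: same_sub (same_trans sm3 sm4); apply/allP.
rewrite /mask_time.
have := width_gt0 p; have := logw_lt_width p; have := len_gt0 p; nia.
Qed.

(** * Joint executions *)

Lemma sub_reg_inj : injective sub_reg.
Proof. by move=> x y; rewrite /sub_reg; case: ifP; case: ifP; lia. Qed.

Lemma sub_arr_inj : injective sub_arr.
Proof.
move=> x y; rewrite /sub_arr /aInbox /aOutbox.
by case: ifP; case: ifP; lia.
Qed.

Lemma rename_id c : rename id id c = c.
Proof. by elim: c => //= *; congruence. Qed.

(** The index is the role in the oblivious transfer: the chooser's code is used verbatim, the
    sender's is renamed. *)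
Definition role_reg (i : bool) : nat -> nat := if i then id else sub_reg.
Definition role_arr (i : bool) : nat -> nat := if i then id else sub_arr.

Lemma role_reg_inj i : injective (role_reg i).
Proof. by case: i => //; apply: sub_reg_inj. Qed.

Lemma role_arr_inj i : injective (role_arr i).
Proof. by case: i => //; apply: sub_arr_inj. Qed.

Lemma jstep_tick c K m k :
  thr c (turn c) = (k :: K, m) -> k <> Yield ->
  jstep c = Conf (turn c) (upd (thr c) (turn c) (tick (k :: K, m))) (log c).
Proof. by rewrite /jstep => ->; case: k. Qed.

Section Link.

Variables (R0 : nat -> nat) (A0 : nat -> seq nat) (pre : bitseq).

Definition linked_thread (n : nat) (i : bool) (t1 t2 : thread) : Prop :=
  renames (role_reg i) (role_arr i) [::] R0 A0 (if i then [::] else pre) n t1 t2.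

(* The parties are exchanged: the chooser, party 2 of the oblivious transfer,
   is party 1 of the indirect indexing. *)
Record linked (n : nat) (c c' : conf) : Prop := Linked {
  linked_turn : turn c' = ~~ turn c;
  linked_log : log c' = [seq (~~ e.1, e.2) | e <- log c];
  linked_thr : forall i, linked_thread n i (thr c i) (thr c' (~~ i))
}.

Lemma linked_threadW n i t1 t2 :
  linked_thread n.+1 i t1 t2 -> linked_thread n i t1 t2.
Proof. exact: renames_le. Qed.

Lemma linked_halted n i t1 t2 :
  linked_thread n i t1 t2 -> halted t2 = halted t1.
Proof. by move=> /rn_stack; rewrite /halted cats0 => ->; case: (t1.1). Qed.

Lemma linked_finished n c c' : linked n c c' -> finished c' = finished c.
Proof.
move=> [_ _ lk]; rewrite /finished andbC.
by rewrite (linked_halted (lk false)) (linked_halted (lk true)).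
Qed.

(** [sub_arr] fixes the inbox and the outbox, so transmitting a message preserves the link in either
    role. *)
Lemma linked_thread_set_arr n i a s K1 m1 K2 m2 :
  a \in [:: aInbox; aOutbox] ->
  linked_thread n i (K1, m1) (K2, m2) ->
  linked_thread n i (K1, set_arr m1 a s) (K2, set_arr m2 a s).
Proof.
move=> aP; have {2}-> : a = role_arr i a.
  by case: i => //=; rewrite /sub_arr; move: aP; rewrite !inE => ->.
exact/renames_set_arr/role_arr_inj.
Qed.

Lemma linked_outbox n i K1 m1 K2 m2 :
  linked_thread n i (K1, m1) (K2, m2) -> arr m2 aOutbox = arr m1 aOutbox.
Proof. by move=> /rn_arr /(_ aOutbox); case: i. Qed.

Lemma linked_pop n i c K1 m1 K2 m2 :
  linked_thread n i (c :: K1, m1) (rename (role_reg i) (role_arr i) c :: K2, m2) ->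
  linked_thread n i (K1, m1) (K2, m2).
Proof. by case=> /= -[st]; split. Qed.

(** Lock step: one joint step matches exactly one joint step, whether the active stack is empty,
    starts with [Yield] or with another command. The coin reserve drops for both parties, although
    at most one of them tosses. *)
Lemma linked_jstep n c c' : linked n.+1 c c' -> linked n (jstep c) (jstep c').
Proof.
move=> lk; have fin := linked_finished lk; case: lk => tn lg th.
case: c c' tn lg th fin => i f l [i' f' l'] /= -> -> th fin.
have thi := th i; have thj := th (~~ i).
case fi: (f i) thi => [K m]; case fi': (f' (~~ i)) => [K' m'].
case fj: (f (~~ i)) thj => [Kj mj]; case fj': (f' (~~ ~~ i)) => [Kj' mj'].
move=> thj thi; have := rn_stack thi; rewrite /= cats0 => KE.
rewrite /jstep /= fi fi' fj fj'.
case: K => [|k K] in fi thi KE *.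
  rewrite KE /= in fi' *; rewrite fin; case: ifP => _; split=> //= q;
    exact/linked_threadW/th.
rewrite KE /= in fi' thi *.
have [kY|kY] : k = Yield \/ k <> Yield by case: (k); by [left|right].
  subst k => /=; split=> //=.
    by rewrite map_rcons /= (linked_outbox thi).
  move=> q; rewrite (inj_eq (can_inj negbK)) (linked_outbox thi).
  case: (eqVneq q i) => [->|qi]; apply: linked_thread_set_arr => //.
    exact/linked_pop/linked_threadW/thi.
  have -> : q = ~~ i by case: (q) (i) qi => [] [].
  exact/linked_threadW/thj.
have kY' : rename (role_reg i) (role_arr i) k <> Yield by case: (k) kY.
have jE := @jstep_tick (Conf i f l) K m k fi kY.
have jE' := @jstep_tick (Conf (~~ i) f' [seq (~~ e.1, e.2) | e <- l]) _ m' _ fi' kY'.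
rewrite /jstep /= fi fj in jE; rewrite /jstep /= fi' fj' in jE'.
rewrite {}jE {}jE'; split=> //= q; rewrite /upd (inj_eq (can_inj negbK)).
case: (eqVneq q i) => [->|qi]; last exact/linked_threadW/th.
by apply: renames_tick thi => //; [exact: role_reg_inj | exact: role_arr_inj].
Qed.

Lemma linked_run n c c' : linked n c c' ->
  linked 0 (iter n jstep c) (iter n jstep c').
Proof.
by elim: n c c' => // n IH c c' lk; rewrite !iterSr; apply/IH/linked_jstep.
Qed.

End Link.

Lemma finished_jstep c : finished c -> jstep c = c.
Proof.
move=> fc; have : halted (thr c (turn c)).
  by move: fc => /andP[]; case: (turn c).
by rewrite /jstep fc; case: (thr c _) => [[|k K] m].
Qed.

Lemma finished_iter c n : finished c -> iter n jstep c = c.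
Proof. by move=> fc; elim: n => //= n ->; apply: finished_jstep. Qed.

Lemma finished_le c s t : s <= t -> finished (iter s jstep c) ->
  iter t jstep c = iter s jstep c.
Proof. by move=> /subnK <- fc; rewrite iterD finished_iter. Qed.

(* [iota 4 16] and [iota 4 4] are the registers and arrays that [sub_reg] and
   [sub_arr] leave to the caller, besides [aIn] and [aOut]. *)
Lemma fresh_renames p z r m z' r' m' m2 pre e c K0 n :
  fresh p z r m -> fresh p z' r' m' -> arr m' aInbox = arr m aInbox ->
  n <= size r ->
  same (iota 4 16) [:: aOut, sub_arr aIn & iota 4 4]
    (Memory (reg m') (arr m') (r ++ e) pre) m2 ->
  arr m2 (sub_arr aIn) = cells z ->
  renames sub_reg sub_arr K0 (reg m2) (arr m2) pre n ([:: c], m)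
    (rename sub_reg sub_arr c :: K0, m2).
Proof.
move=> fm fm' inb szn sm x2.
split=> //=.
- move=> x; rewrite (fresh_reg fm) /sub_reg; case: ltnP => x4.
    rewrite (same_reg sm) ?mem_iota; last by lia.
    by rewrite /= (fresh_reg fm').
  rewrite (same_reg sm) ?mem_iota; last by lia.
  by rewrite /= (fresh_reg fm') !nth_default //=; lia.
- move=> a; have [->|aI] := eqVneq a aIn.
    by rewrite x2 (fresh_in fm).
  rewrite (same_arr sm) /=; last first.
    by rewrite !inE /sub_arr; move: aI; rewrite /aIn /aOut /aInbox /aOutbox /=;
      case: ifP; lia.
  have [->|aB] := eqVneq a aInbox; first exact: inb.
  rewrite (fresh_arr fm) ?inE ?negb_or ?aI // (fresh_arr fm') //.
  rewrite !inE /sub_arr; move: aI aB; rewrite /aIn /aInbox /aOutbox.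
  by case: ifP; lia.
- by exists e; rewrite (same_tape sm) (fresh_tape fm).
- by rewrite (fresh_tape fm).
- by rewrite (same_tossed sm) (fresh_tossed fm) cats0.
Qed.

Section Execution.

Variables (Q : protocol) (p : param) (pi : (logw p).-tuple bool).
Variables (y : strings p) (J : bitseq) (mask : (len p).-tuple bool).
Variables (tS tC eS eC : bitseq).

Let x := code_strings (offered pi mask y).
Let z := pi ++ code_strings y.

(* The chooser speaks first, and the sender has not been active yet. *)
Record waiting (n : nat) (c c' : conf) : Prop := Waiting {
  wt_turn : turn c;
  wt_turn' : turn c' = false;
  wt_log : log c' = [seq (~~ e.1, e.2) | e <- log c];
  wt_sender : thr c false = ([:: party1 Q], load p x tS);
  wt_sender' : thr c' true = ([:: party2 (P_Ind Q)], load p z (mask ++ tS ++ eS));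
  wt_size : n <= size tS;
  wt_chooser : forall R0 A0 pre,
    linked_thread R0 A0 pre n true (thr c true) (thr c' false)
}.

(** When the sender gets its first turn, Bob prepares while the oblivious transfer stands still;
    from then on the executions are linked. The memories are only [fresh], as a message may already
    have arrived. The chooser's link is required for all [R0], [A0], [pre], because these are known
    only after the preparation. *)
Lemma sender_starts n c c' l u m m' :
  turn c = false -> thr c false = ([:: party1 Q], m) ->
  fresh p x tS m -> fresh p z (mask ++ tS ++ eS) m' ->
  arr m' aInbox = arr m aInbox -> n <= size tS ->
  active c' true [:: party2 (P_Ind Q)] m' u l ->
  l = [seq (~~ e.1, e.2) | e <- log c] ->
  (forall R0 A0 pre, linked_thread R0 A0 pre n true (thr c true) u) ->
  exists s R0 A0, [/\ s <= mask_time p, A0 aOut = cells mask &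
    linked R0 A0 mask n c (iter s jstep c')].
Proof.
move=> tn th fm fm' inb szn ac lE lku.
have [s [m2 [sT [sm [o2 x2]] _ js]]] := mask_leads Q fm'.
have {js}[tn' th' thn' lg'] := js _ _ _ _ _ ac.
exists s, (reg m2), (arr m2); split=> //; split=> //.
- by rewrite tn' tn.
- by rewrite lg'.
case=> /=; first by rewrite thn'; apply: lku.
rewrite th th'.
apply: fresh_renames fm fm' inb szn _ x2.
by apply: same_sub sm; apply/allP.
Qed.

(** The wait ends when the chooser sends its first message or halts without sending one. One of
    these must occur, since a finished execution has run the sender. *)
Lemma waiting_run n c c' : waiting n c c' -> finished (iter n jstep c) ->
  exists s R0 A0, [/\ s <= mask_time p + n, A0 aOut = cells mask &
    linked R0 A0 mask 0 (iter n jstep c) (iter s jstep c')].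
Proof.
elim: n c c' => [|n IH] c c' wt.
  (* With no step left, the execution would be finished while the sender's code is still on its
     stack. *)
  by rewrite /finished /= (wt_sender wt).
rewrite iterSr => fin.
have finish c1 : (exists s R0 A0, [/\ s <= mask_time p, A0 aOut = cells mask &
      linked R0 A0 mask n (jstep c) (iter s jstep c1)]) ->
    c1 = jstep c' ->
    exists s R0 A0, [/\ s <= mask_time p + n.+1, A0 aOut = cells mask &
      linked R0 A0 mask 0 (iter n jstep (jstep c)) (iter s jstep c')].
  move=> [s [R0 [A0 [sT Ao lk]]]] c1E; exists (n + s).+1, R0, A0; split=> //.
    by lia.
  by rewrite iterSr iterD -c1E; apply: linked_run.
case: wt => tn tn' lg th th' sz thC.
case: c c' tn tn' lg th th' thC fin finish => i f l [i' f' l'] /=.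
move=> -> -> -> fs fs' thC fin finish.
case fc: (f true) thC => [K m]; case fc': (f' false) => [K' m'] thC.
have KE : K' = [seq rename id id k | k <- K].
  by have := rn_stack (thC id (fun=> [::]) [::]); rewrite /= cats0.
have {KE} KE : K' = K.
  by rewrite KE -[RHS]map_id; apply: eq_map => k; apply: rename_id.
subst K'.
have outE : arr m' aOutbox = arr m aOutbox.
  exact: (linked_outbox (thC id (fun=> [::]) [::])).
case: K => [|k K] in fc fc' thC *.
  have jE : jstep (Conf true f l) = Conf false f l.
    by rewrite /jstep /= fc /finished /= fs.
  have jE' : jstep (Conf false f' [seq (~~ e.1, e.2) | e <- l]) =
      Conf true f' [seq (~~ e.1, e.2) | e <- l].
    by rewrite /jstep /= fc' /finished /= fs' andbF.
  apply: finish (esym jE'); rewrite jE.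
  apply: (@sender_starts n (Conf false f l) _ _ (f' false) _ _ _ fs
    (fresh_load _ _ _) (fresh_load _ _ _)) => //=.
  - exact: ltnW.
  - by move=> R0 A0 pre; rewrite /= fc fc'; apply/linked_threadW/thC.
have [kY|kY] : k = Yield \/ k <> Yield by case: (k); by [left|right].
  subst k.
  have jE : jstep (Conf true f l) = Conf false
      (fun j => if j == true then (K, set_arr m aOutbox [::]) else
         ([:: party1 Q], set_arr (load p x tS) aInbox (cells (bits (arr m aOutbox)))))
      (rcons l (true, bits (arr m aOutbox))).
    by rewrite /jstep /= fc fs.
  have jE' : jstep (Conf false f' [seq (~~ e.1, e.2) | e <- l]) = Conf true
      (fun j => if j == false then (K, set_arr m' aOutbox [::]) else
         ([:: party2 (P_Ind Q)], set_arr (load p z (mask ++ tS ++ eS)) aInbox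
            (cells (bits (arr m aOutbox)))))
      (rcons [seq (~~ e.1, e.2) | e <- l] (false, bits (arr m aOutbox))).
    by rewrite /jstep /= fc' fs' outE.
  apply: finish (esym jE'); rewrite jE.
  apply: (@sender_starts n (Conf _ _ _) _ _ (K, set_arr m' aOutbox [::])
    _ _ _ erefl
    (fresh_inbox _ (fresh_load _ _ _)) (fresh_inbox _ (fresh_load _ _ _))) => //=.
  - exact: ltnW.
  - by rewrite map_rcons.
  - move=> R0 A0 pre /=; apply: linked_thread_set_arr => //.
    have := linked_threadW (thC R0 A0 pre).
    by rewrite -[X in (X :: K, m')](rename_id Yield); apply: linked_pop.
have jE := @jstep_tick (Conf true f l) K m k fc kY.
have jE' := @jstep_tick (Conf false f' [seq (~~ e.1, e.2) | e <- l]) K m' k fc' kY.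
have [|s [R0 [A0 [sT Ao lk]]]] := IH _ (jstep (Conf false f'
    [seq (~~ e.1, e.2) | e <- l])) _ fin.
  rewrite jE jE'; split=> //=; rewrite /upd //=.
  - exact: ltnW.
  - move=> R0 A0 pre; apply: renames_tick (thC R0 A0 pre) => //.
exists s.+1, R0, A0; split=> //; first by lia.
by rewrite iterSr.
Qed.

Definition same_run (cQ cP : conf) : Prop :=
  [/\ log cP = [seq (~~ e.1, e.2) | e <- log cQ],
      tossed (thr cP false).2 = tossed (thr cQ true).2,
      tossed (thr cP true).2 = mask ++ tossed (thr cQ false).2,
      arr (thr cP false).2 aOut = arr (thr cQ true).2 aOut &
      arr (thr cP true).2 aOut = cells mask].

Lemma P_Ind_run n T :
  n <= size tS -> n <= size tC -> mask_time p + n <= T ->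
  finished (execute Q n p x J tS tC) ->
  let cP := execute (P_Ind Q) T p J z (tC ++ eC) (mask ++ tS ++ eS) in
  finished cP /\ same_run (execute Q n p x J tS tC) cP.
Proof.
move=> nS nC nT fin /=.
have link0 R0 A0 pre : linked_thread R0 A0 pre n true
    ([:: party2 Q], load p J tC) ([:: party2 Q], load p J (tC ++ eC)).
  split=> //=; first by rewrite rename_id.
  - by move=> r /(_ r); rewrite eqxx.
  - by move=> r /(_ r); rewrite eqxx.
  - by exists eC.
have [s [R0 [A0 [sT Ao lk]]]] : exists s R0 A0,
    [/\ s <= mask_time p + n, A0 aOut = cells mask &
     linked R0 A0 mask 0 (execute Q n p x J tS tC)
       (iter s jstep (start (P_Ind Q) p J z (tC ++ eC) (mask ++ tS ++ eS)))].
  (* If the chooser is active first, Bob waits; otherwise he prepares at once. *)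
  case tnQ: (first Q).
    by apply: waiting_run => //; split=> //=; rewrite tnQ.
  have [|s [R0 [A0 [sT Ao lk]]]] := @sender_starts n (start Q p x J tS tC)
    (start (P_Ind Q) p J z (tC ++ eC) (mask ++ tS ++ eS))
    [::] ([:: party2 Q], load p J (tC ++ eC)) _ _ tnQ erefl
    (fresh_load _ _ _) (fresh_load _ _ _) erefl nS _ erefl link0.
    by split=> //=; rewrite tnQ.
  exists (n + s), R0, A0; split=> //; first by lia.
  by rewrite iterD; apply: linked_run.
have finP := linked_finished lk; rewrite fin in finP.
rewrite /execute (finished_le (leq_trans sT nT) finP); split=> //.
case: lk => _ lg th; split=> //.
- by have := rn_tossed (th true).
- by have := rn_tossed (th false).
- by have := rn_arr (th true) aOut.
(* [aOut] is outside the range of [sub_arr], so the sender cannot alter the mask stored there. *)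
- have := rn_arr0 (th false); rewrite /= => ->; first exact: Ao.
  by move=> b; rewrite /sub_arr; case: ifP; rewrite /aOut /aInbox /aOutbox; lia.
Qed.

End Execution.

(** * The simulator for Bob *)

(** This register must survive the run of [S]: 13 lies between the parameters and the registers
    shifted by [sub_reg]. *)
Definition rN := 13.
Definition aMask := 5.

(** After [positions], [rPos] points just past the coded strings, where a simulator for Bob finds
    his output pi'. *)
Definition copy_mask : cmd :=
  For rJ rLen rU
    (Get rB aIn rPos ;; Push aMask rB ;; Const rC 1 ;; Plus rPos rPos rC).

Definition emit (n a : nat) : cmd :=
  For rI n rT (Const rC 1 ;; Push aOut rC ;; Get rB a rI ;; Push aOut rB).

Definition copy_rest : cmd :=
  Len rC (sub_arr aOut) ;; Minus rC rC rN ;;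
  For rI rC rT
    (Plus rB rN rI ;; Get rB (sub_arr aOut) rB ;; Push aOut rB).

(* The simulator for Bob turns a simulated view of the sender into one of Bob:
   it drops the encoding of the offered strings, whose length is in [rN], and
   prepends the encoding of Bob's input and that of pi' without its end mark. *)
Definition bob_simulator (S : cmd) : cmd :=
  read_pi ;; positions ;; Const rN 0 ;; Plus rN rN rPos ;; copy_mask ;;
  mask_strings_with aMask ;; emit rN aIn ;;
  Const rC 0 ;; Push aOut rC ;; Const rC 1 ;; Push aOut rC ;;
  emit rLen aMask ;;
  Len rN (sub_arr aIn) ;; Plus rN rN rN ;; Const rC 2 ;; Plus rN rN rC ;;
  rename sub_reg sub_arr S ;; copy_rest.

(** Bob's coins are pi' followed by the sender's, so [pairs mask] is exactly what turns the encoding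
    of the sender's coins into that of Bob's. *)
Definition pairs (s : bitseq) : bitseq := flatten [seq [:: true; b] | b <- s].

Lemma copy_mask_spec m n q (s : n.-tuple bool) t :
  reg m rLen = n -> reg m rPos = q -> size t = q ->
  arr m aIn = cells (t ++ s) -> arr m aMask = [::] ->
  wp (n * 14 + 5) copy_mask m (fun m' =>
    same [:: rJ; rU; rB; rC; rPos] [:: aMask] m m' /\ arr m' aMask = cells s).
Proof.
move=> rn rq szt ain am.
pose I k m' := [/\ same [:: rJ; rU; rB; rC; rPos] [:: aMask] m m',
  arr m' aMask = cells (take k s) & reg m' rPos = q + k].
suff loop : wp (n * (7 + 7) + 5) copy_mask m (I n).
  wp_use loop => m' [sm am' _]; split=> //.
  by rewrite am' take_oversize ?size_tuple.
apply: (wp_for (I := I)) => //.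
- by move=> k m2 [sm _ _]; rewrite (same_reg sm).
- by move=> k m2 v [sm am2 pm]; split=> //; apply: same_set_reg.
- by move=> k m2 v [sm am2 pm]; split=> //; apply: same_set_reg.
- move=> k m2 kl ik [sm am2 pm].
  wp_start; first do 7 wp_step; last by [].
  split=> //; split; first same_tac => //.
    rewrite /effect /= /upd /= am2 pm (same_arr sm) // ain nth_cells.
    rewrite nth_cat szt ltnNge leq_addr addKn (take_nth false) ?size_tuple //.
    by rewrite cells_rcons.
  by rewrite /effect /= /upd /= pm addn1 addnS.
- by split; rewrite ?take0 ?addn0.
Qed.

Lemma emit_spec m rn a (s : bitseq) rest out :
  rn \notin [:: rI; rT; rB; rC] -> a != aOut ->
  reg m rn = size s -> arr m a = cells s ++ rest -> arr m aOut = cells out ->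
  wp (size s * 14 + 5) (emit rn a) m (fun m' =>
    same [:: rI; rT; rB; rC] [:: aOut] m m' /\
    arr m' aOut = cells (out ++ pairs s)).
Proof.
move=> rnP aP szs am om.
pose I k m' := same [:: rI; rT; rB; rC] [:: aOut] m m' /\
  arr m' aOut = cells (out ++ pairs (take k s)).
suff loop : wp (size s * (7 + 7) + 5) (emit rn a) m (I (size s)).
  by wp_use loop => m' [sm om']; rewrite take_size in om'.
apply: (wp_for (I := I)) => //.
- by apply: contra rnP => /eqP <-.
- by apply: contra rnP => /eqP <-.
- by move=> k m2 [sm _]; rewrite (same_reg sm).
- by move=> k m2 v [sm om2]; split=> //; apply: same_set_reg.
- by move=> k m2 v [sm om2]; split=> //; apply: same_set_reg.
- move=> k m2 kl ik [sm om2].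
  wp_start; first do 7 wp_step; last by [].
  split=> //; split; first same_tac => //.
  rewrite /effect; cbn [tick snd set_reg set_arr reg arr]; rewrite /upd /=.
  rewrite (negbTE aP) om2 ik (same_arr sm) ?inE // am.
  rewrite nth_cat size_cells kl nth_cells (take_nth false) //.
  rewrite /pairs map_rcons flatten_rcons catA -!cats1 -!catA.
  by rewrite [in RHS]catA [in RHS]cells_cat.
- by split=> //; rewrite take0 cats0.
Qed.

Lemma copy_rest_spec m :
  wp (size (arr m (sub_arr aOut)) * 12 + 9) copy_rest m (fun m' =>
    arr m' aOut = arr m aOut ++ drop (reg m rN) (arr m (sub_arr aOut))).
Proof.
set v := arr m (sub_arr aOut); set n := reg m rN.
pose I k m' := [/\ same [:: rI; rT; rB; rC] [:: aOut] m m',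
  reg m' rC = size v - n & arr m' aOut = arr m aOut ++ take k (drop n v)].
suff loop m1 : I 0 m1 -> wp ((size v - n) * (5 + 7) + 5)
    (For rI rC rT (Plus rB rN rI ;; Get rB (sub_arr aOut) rB ;; Push aOut rB))
    m1 (I (size v - n)).
  rewrite /copy_rest; wp_start.
    do 4 wp_step; wp_use (loop _ _) => [|m' [_ _ om]].
      by split; [same_tac | rewrite /effect /= /upd /= | rewrite take0 cats0].
    by rewrite om take_oversize // size_drop.
  by rewrite /=; lia.
move=> I0; apply: (wp_for (I := I)) => //.
- by move=> k m2 [].
- by move=> k m2 x [sm rm om]; split=> //; apply: same_set_reg.
- by move=> k m2 x [sm rm om]; split=> //; apply: same_set_reg.
move=> k m2 kl ik [sm rm om].
wp_start; first do 5 wp_step; last by [].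
split=> //; split; first same_tac => //.
  by rewrite /effect /= /upd /=.
rewrite /effect; cbn [tick snd set_reg set_arr reg arr]; rewrite /upd /=.
rewrite om ik (same_arr sm) // (same_reg sm) // (take_nth 0) ?size_drop //.
by rewrite nth_drop rcons_cat.
Qed.

(** An array grows by at most one cell per step, so the output of [S] is no longer than its running
    time; this bounds the time of [copy_rest]. *)
Lemma size_arr_tick t a : size (arr (tick t).2 a) <= (size (arr t.2 a)).+1.
Proof.
case: t => [[|[|x k|x y z|x y z|x y z|x b|x b i|b i x|b x|x||c d|x c d|x c] K] m] //=.
- case: ifP => //= lt; rewrite /upd; case: eqP => // ->.
  by rewrite size_set_nth (maxn_idPr lt).
- by rewrite /upd; case: eqP => // ->; rewrite size_rcons.
Qed.

Lemma size_arr_run n t a :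
  size (arr (iter n tick t).2 a) <= n + size (arr t.2 a).
Proof.
elim: n => //= n IH; apply: leq_trans (size_arr_tick _ _) _.
by rewrite addSn ltnS.
Qed.

Lemma halted_iter n t : halted t -> iter n tick t = t.
Proof. by case: t => [[|//] m] _; elim: n => //= n ->. Qed.

Section Simulator.

Variables (S : cmd) (p : param) (pi : (logw p).-tuple bool).
Variables (y : strings p) (mask : (len p).-tuple bool) (r e : bitseq).

Let x := offered pi mask y.
Let z := pi ++ code_strings y.
Let view0 := encode z ++ pairs mask.

Lemma bob_simulator_leads m r' :
  fresh p (z ++ mask) r' m -> arr m aInbox = [::] ->
  leads (300 * (width p * len p)) (bob_simulator S) m
    (rename sub_reg sub_arr S ;; copy_rest) (fun m' =>
    [/\ same [:: rI; rT; rJ; rU; rB; rC; rPi; rPow; rPos; rN]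
         [:: aOut; aPos; aMask; sub_arr aIn] m m',
        reg m' rN = size (encode (code_strings x)),
        arr m' aOut = cells view0 &
        arr m' (sub_arr aIn) = cells (code_strings x)]).
Proof.
move=> [rg ain ar tp ts] inb; rewrite /bob_simulator.
leads_start.
  apply: leads_seq.
  wp_use (read_pi_spec (pi := pi) (rest := cells (code_strings y ++ mask)) _ _)
    => [||m1 [sm1 pi1]].
  - by rewrite rg.
  - by rewrite ain /z -catA cells_cat.
  apply: leads_seq.
  wp_use (positions_spec (l := logw p) (n := len p) (w := width p) _ _ _ _)
    => [||||m2 [sm2 q2 pos2]].
  - by rewrite (same_reg sm1) //= rg.
  - by rewrite (same_reg sm1) //= rg.
  - by rewrite (same_reg sm1) //= rg.
  - by rewrite (same_arr sm1) //= ar.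
  have pi2 : reg m2 rPi = string_value pi by rewrite (same_reg sm2).
  have {sm1} sm2 := same_trans sm1 sm2.
  have sz : size z = logw p + width p * len p.
    by rewrite size_cat size_tuple size_code_strings.
  apply: leads_seq; wp_step; apply: leads_seq; wp_step.
  set m3 := effect _ _.
  have n3 : reg m3 rN = size z by rewrite /m3 /effect /= /upd /= q2 sz.
  have sm3 : same [:: rN] [::] m2 m3 by rewrite /m3; same_tac.
  have {sm2} sm3' := same_trans sm2 sm3.
  apply: leads_seq.
  wp_use (copy_mask_spec (q := size z) (s := mask) (t := z) _ _ _ _ _)
    => [|||||m4 [sm4 k4]] //.
  - by rewrite (same_reg sm3') //= rg.
  - by rewrite (same_arr sm3') //.
  - by rewrite (same_arr sm3') // ar.
  have sm34 := same_trans sm3 sm4.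
  have sm4' := same_trans sm3' sm4.
  apply: leads_seq.
  wp_use (@mask_strings_spec p pi y mask aMask m4 (cells mask) _ _ _ _ _ _ _ _)
    => [||||||||m5 [sm5 x5]] //.
  - by rewrite (same_reg sm4') //= rg.
  - by rewrite (same_reg sm4') //= rg.
  - by rewrite (same_reg sm34).
  - by rewrite (same_arr sm34).
  - by rewrite (same_arr sm4') // ain cells_cat.
  - by rewrite (same_arr sm4') // ar.
  have n5 : reg m5 rN = size z by rewrite (same_reg sm5) // (same_reg sm4).
  have k5 : arr m5 aMask = cells mask by rewrite (same_arr sm5).
  have {sm4'} sm5' := same_trans sm4' sm5.
  apply: leads_seq.
  wp_use (emit_spec (s := z) (rest := cells mask) (out := [::]) _ _ n5 _ _)
    => [||||m6 [sm6 o6]] //.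
  - by rewrite (same_arr sm5') // ain cells_cat.
  - by rewrite (same_arr sm5') // ar.
  apply: leads_seq; wp_step; apply: leads_seq; wp_step.
  apply: leads_seq; wp_step; apply: leads_seq; wp_step.
  set m7 := effect _ _.
  have sm7 : same [:: rC] [:: aOut] m6 m7 by rewrite /m7; same_tac.
  have o7 : arr m7 aOut = cells (encode z).
    by rewrite /m7 /effect /= /upd /= o6 -!cats1 -catA /encode [in RHS]cells_cat.
  have {}sm7 := same_trans sm6 sm7.
  have sm7' := same_trans sm5' sm7.
  apply: leads_seq.
  wp_use (@emit_spec m7 rLen aMask mask [::] (encode z) _ _ _ _ _)
    => [|||||m8 [sm8 o8]] //.
  - by rewrite (same_reg sm7') // rg size_tuple.
  - by rewrite cats0 (same_arr sm7).
  have {}sm8 := same_trans sm7 sm8.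
  have x8 : arr m8 (sub_arr aIn) = cells (code_strings x) by rewrite (same_arr sm8).
  have {}sm8 := same_trans sm5' sm8.
  apply: leads_seq; wp_step; apply: leads_seq; wp_step.
  apply: leads_seq; wp_step; apply: leads_seq; wp_step.
  apply: leads_refl.
  set m9 := effect _ _.
  have sm9 : same [:: rN; rC] [::] m8 m9 by rewrite /m9; same_tac.
  split.
  - by apply: same_sub (same_trans sm8 sm9); apply/allP.
  - rewrite /m9 /effect /= /upd /= [arr m8 _]x8 size_cells.
    rewrite /encode size_cat -/(pairs _) /pairs.
    by elim: (code_strings x) => //= b s IH; lia.
  - by rewrite (same_arr sm9).
  - by rewrite (same_arr sm9).
have sz : size z = logw p + width p * len p.
  by rewrite size_cat size_tuple size_code_strings.
rewrite sz size_tuple.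
have := width_gt0 p; have := logw_lt_width p; have := len_gt0 p; nia.
Qed.

(** Of [13 * n + 10] steps, [n] are for [S], [12 * n + 9] for copying at most [n] cells and one for
    sequencing. The [[::]] is the empty output of the sender, part of the input of its simulator. *)
Lemma bob_simulator_run n T :
  n <= size r -> halted (run S n p (code_strings x ++ [::]) r) ->
  300 * (width p * len p) + 13 * n + 10 <= T ->
  let t := run (bob_simulator S) T p (z ++ mask) (r ++ e) in
  halted t /\
  bits (arr t.2 aOut) = view0 ++ drop (size (encode (code_strings x)))
    (bits (arr (run S n p (code_strings x ++ [::]) r).2 aOut)).
Proof.
rewrite cats0 => nr ht nT t.
have fP := fresh_load p (z ++ mask) (r ++ e).
have [s1 [m1 [s1T [sm n1 o1 x1] tk _]]] := bob_simulator_leads fP erefl.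
have rn : renames sub_reg sub_arr [:: copy_rest] (reg m1) (arr m1) [::] n
    ([:: S], load p (code_strings x) r)
    ([:: rename sub_reg sub_arr S; copy_rest], m1).
  apply: fresh_renames (fresh_load _ _ _) fP _ nr _ x1 => //.
  by apply: same_sub sm; apply/allP.
have [s2 s2n] := renames_run sub_reg_inj sub_arr_inj rn ht.
have := size_arr_run n ([:: S], load p (code_strings x) r) aOut.
rewrite -/(run S n p (code_strings x) r) addn0.
case: (run S n p (code_strings x) r) ht => [[|//] mS] _ /= szS.
case E2: (iter s2 tick _) => [K2 m2] rn2.
have KE : K2 = [:: copy_rest] by apply: (rn_stack rn2).
have oS := rn_arr rn2 aOut; rewrite /= in oS.
have n2 : reg m2 rN = size (encode (code_strings x)).
  rewrite -n1; apply: (rn_reg0 rn2) => b; rewrite /sub_reg /rN.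
  by case: ifP; lia.
have o2 : arr m2 aOut = cells view0.
  rewrite -o1; apply: (rn_arr0 rn2) => b.
  by rewrite /sub_arr /aOut /aInbox /aOutbox; case: ifP; lia.
have [s3 [m3 [s3T ex3 o3]]] := copy_rest_spec m2.
rewrite oS n2 o2 in s3T o3.
have haltE : iter (s3 + (s2 + s1.+1)) tick
    ([:: bob_simulator S], load p (z ++ mask) (r ++ e)) = ([::], m3).
  rewrite !iterD iterS tk /= E2 KE.
  exact: exec_ticks.
have tE : t = ([::], m3).
  rewrite /t /run -(@subnK (s3 + (s2 + s1.+1)) T); last by lia.
  by rewrite iterD haltE halted_iter.
by rewrite tE /= o3 /bits map_cat map_drop -/(bits _) bits_cells.
Qed.

End Simulator.

(** * Averages and circuits *)

Section Averages.

Import Order.TTheory GRing.Theory Num.Theory.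

Local Open Scope ring_scope.

Definition avg (A : finType) (F : A -> rat) : rat := (\sum_a F a) / #|A|%:R.

Lemma eq_avg (A : finType) (F G : A -> rat) : F =1 G -> avg F = avg G.
Proof. by move=> FG; rewrite /avg (eq_bigr G). Qed.

Lemma prob_accept_avg C D :
  prob_accept C D = avg (fun e => (accepts C (@sample D e))%:R).
Proof.
rewrite /prob_accept /avg -sum1_card natr_sum big_mkcond /=.
by congr (_ / _); apply: eq_bigr => e _; rewrite inE; case: accepts.
Qed.

Lemma avg_pair (A B : finType) (F : A * B -> rat) :
  avg F = avg (fun a => avg (fun b => F (a, b))).
Proof.
rewrite /avg -big_distrl /= pair_big /= card_prod natrM invfM mulrA mulrAC.
by congr (_ / _ / _); apply: eq_bigr => -[].
Qed.

Lemma avg_exchange (A B : finType) (F : A -> B -> rat) :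
  avg (fun a => avg (F a)) = avg (fun b => avg (F^~ b)).
Proof. by rewrite /avg -!big_distrl /= exchange_big /= mulrAC. Qed.

Lemma avg_const (A : finType) (q : rat) :
  (0 < #|A|)%N -> avg (fun _ : A => q) = q.
Proof.
move=> A0; rewrite /avg sumr_const -[q *+ _]mulr_natr mulfK //.
by rewrite pnatr_eq0 -lt0n.
Qed.

Lemma card_bits n : (0 < #|{: n.-tuple bool}|)%N.
Proof. by rewrite card_tuple expn_gt0 card_bool. Qed.

Lemma avg_split (m n N : nat) (F : bitseq -> bitseq -> rat) : N = (m + n)%N ->
  avg (fun r : N.-tuple bool => F (take m r) (drop m r)) =
  avg (fun s : m.-tuple bool => avg (fun t : n.-tuple bool => F s t)).
Proof.
move=> ->; rewrite -(avg_pair (fun st => F (tval st.1) (tval st.2))).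
pose h (st : m.-tuple bool * n.-tuple bool) := [tuple of st.1 ++ st.2].
have hE st : (take m (h st) = st.1) * (drop m (h st) = st.2).
  by rewrite /= take_size_cat ?drop_size_cat ?size_tuple.
have h_inj : injective h.
  move=> s t st; apply/eqP; rewrite -pair_eqE /=; apply/andP.
  by split; apply/eqP/val_inj; rewrite /= -!hE st.
have [g hK gK] : bijective h.
  by apply: inj_card_bij h_inj _; rewrite card_prod !card_tuple expnD.
rewrite /avg (reindex h) /=; last by exists g => ? _.
rewrite card_prod !card_tuple expnD; congr (_ / _); apply: eq_bigr => st _.
by rewrite !hE.
Qed.

Lemma avg_dist (A : finType) (F G : A -> rat) (e : rat) : (0 < #|A|)%N ->
  (forall a, `|F a - G a| < e) -> `|avg F - avg G| < e.
Proof.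
move=> A0 FG; have A0' : 0 < #|A|%:R :> rat by rewrite ltr0n.
rewrite /avg -mulrBl -sumrB normrM normfV (gtr0_norm A0') ltr_pdivrMr //.
apply: le_lt_trans (ler_norm_sum _ _ _) _.
rewrite mulr_natr -sumr_const; apply: ltr_sum => //.
by have /card_gt0P[a _] := A0; apply/hasP; exists a; rewrite ?mem_index_enum.
Qed.

(** * Rewiring the inputs of a circuit *)

Definition rewire (h : nat -> bool + nat) (g : gate) : gate :=
  match g with
  | Input i => match h i with inl b => Constant b | inr j => Input j end
  | _ => g
  end.

Lemma accepts_rewire h C s s' :
  (forall i, nth false s' i =
     match h i with inl b => b | inr j => nth false s j end) ->
  accepts [seq rewire h g | g <- C] s = accepts C s'.
Proof.
move=> hs; rewrite /accepts; elim: C [::] => //= g C IH vals.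
by rewrite IH; case: g => //= i; rewrite hs; case: (h i).
Qed.

Definition prefix_wires (c : bitseq) (i : nat) : bool + nat :=
  if (i < size c)%N then inl (nth false c i) else inr (i - size c)%N.

Lemma accepts_prefix c C s :
  accepts [seq rewire (prefix_wires c) g | g <- C] s = accepts C (c ++ s).
Proof.
by apply: accepts_rewire => i; rewrite nth_cat /prefix_wires; case: ifP.
Qed.

(** After the other party's output, of length [l], the next [n] bits are replaced by [c]. The
    replacement goes by position only, so it makes sense even if a simulator's output is not a
    well-formed view. *)
Definition infix_wires (l : nat) (c : bitseq) (n i : nat) : bool + nat :=
  if (i < l)%N then inr i
  else if (i - l < size c)%N then inl (nth false c (i - l))
  else inr (l + (n + (i - l - size c)))%N.

Lemma accepts_infix a c n C s :
  accepts [seq rewire (infix_wires (size a) c n) g | g <- C] (a ++ s) =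
  accepts C (a ++ c ++ drop n s).
Proof.
apply: accepts_rewire => i; rewrite !nth_cat /infix_wires nth_drop.
case: ifP => [ia|_]; first by rewrite nth_cat ia.
by case: ifP => // _; rewrite nth_cat ltnNge leq_addr addKn.
Qed.

End Averages.

(** * Costs and privacy *)

Lemma avg_cat (m n N : nat) (F : bitseq -> rat) : N = m + n ->
  avg (fun r : N.-tuple bool => F r) =
  avg (fun s : m.-tuple bool => avg (fun t : n.-tuple bool => F (s ++ t))).
Proof.
move=> NE; rewrite -(avg_split (fun s t => F (s ++ t)) NE).
apply: eq_avg => r.
by rewrite cat_take_drop.
Qed.

(** Bob's tape splits into pi', the sender's coins [t] and a surplus, Alice's into the chooser's
    coins [u] and a surplus. The surplus does not affect the value and averages out; the exchange of
    averages accounts for the exchange of parties. *)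
Lemma avg_tapes (l w W : nat) (A : bitseq -> bitseq -> rat)
    (G : l.-tuple bool -> bitseq -> bitseq -> rat) : l + w <= W ->
  (forall (s : l.-tuple bool) (t u : w.-tuple bool) t' u',
     A (u ++ u') (s ++ (t ++ t')) = G s t u) ->
  avg (fun r : W.-tuple bool * W.-tuple bool => A r.1 r.2) =
  avg (fun s => avg (fun r : w.-tuple bool * w.-tuple bool => G s r.1 r.2)).
Proof.
move=> lwW AG.
have step (u u' : bitseq) : size u = w ->
    avg (fun r : W.-tuple bool => A (u ++ u') r) =
    avg (fun s => avg (fun t : w.-tuple bool => G s t u)).
  move=> /eqP uw; rewrite (@avg_cat l (W - l) W (A (u ++ u'))); last by lia.
  apply: eq_avg => s.
  rewrite (@avg_cat w (W - l - w) _ (fun r => A (u ++ u') (s ++ r))); last by lia.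
  apply: eq_avg => t; rewrite -[RHS](avg_const _ (card_bits (W - l - w))).
  by apply: eq_avg => t'; apply: (AG s t (Tuple uw)).
rewrite avg_pair /=.
rewrite (@avg_cat w (W - w) W (fun r1 => avg (fun r2 : W.-tuple bool => A r1 r2)));
  last by lia.
transitivity (avg (fun u : w.-tuple bool =>
    avg (fun s => avg (fun t : w.-tuple bool => G s t u)))).
  apply: eq_avg => u; rewrite -[RHS](avg_const _ (card_bits (W - w))).
  by apply: eq_avg => u'; rewrite step ?size_tuple.
rewrite avg_exchange; apply: eq_avg => s.
by rewrite avg_pair /= avg_exchange.
Qed.

(** The threshold given for [D'] and [E'] is uniform in the input and in the circuit, so it serves
    all [a] at once even though both [f] and the rewiring depend on [a]. Rewiring keeps the number
    of gates, and an average of differences below the bound stays below it. *)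
Lemma indistinguishable_mixture (I I' : param -> Type) (A : param -> finType)
    (D E : forall p, I p -> distribution) (D' E' : forall p, I' p -> distribution)
    (f : forall p, I p -> A p -> I' p)
    (h : forall p, I p -> A p -> nat -> bool + nat) :
  (forall p, 0 < #|A p|) ->
  (forall p i C, prob_accept C (D p i) = avg (fun a =>
     prob_accept [seq rewire (h p i a) g | g <- C] (D' p (f p i a)))) ->
  (forall p i C, prob_accept C (E p i) = avg (fun a =>
     prob_accept [seq rewire (h p i a) g | g <- C] (E' p (f p i a)))) ->
  indistinguishable D' E' -> indistinguishable D E.
Proof.
move=> A0 DA EA ind d; have [K indK] := ind d; exists K => p Kp wp lp i C szC.
rewrite DA EA; apply: avg_dist => // a.
by apply: indK => //; rewrite size_map.
Qed.

Lemma tuple_cat_ex m n N (r : N.-tuple bool) : N = m + n ->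
  exists (s : m.-tuple bool) (t : n.-tuple bool), tval r = s ++ t.
Proof.
move=> NE; have st : size (take m r) == m by rewrite size_takel // size_tuple NE leq_addr.
have sd : size (drop m r) == n by rewrite size_drop size_tuple NE addKn.
by exists (Tuple st), (Tuple sd); rewrite /= cat_take_drop.
Qed.

Lemma pairs_cat s t : pairs (s ++ t) = pairs s ++ pairs t.
Proof. by rewrite /pairs map_cat flatten_cat. Qed.

Lemma encode_cat s t : encode (s ++ t) = pairs s ++ encode t.
Proof. by rewrite /encode -/(pairs _) pairs_cat -catA. Qed.

Lemma messages_swap (l : seq (bool * bitseq)) (i : bool) :
  [seq encode e.2 | e <- [seq (~~ e.1, e.2) | e <- l] & e.1 == ~~ i] =
  [seq encode e.2 | e <- l & e.1 == i].
Proof.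
rewrite filter_map -map_comp; congr map; apply: eq_filter => e /=.
by rewrite (inj_eq (can_inj negbK)).
Qed.

Lemma communication_swap c c' :
  log c' = [seq (~~ e.1, e.2) | e <- log c] -> communication c' = communication c.
Proof. by rewrite /communication => ->; rewrite big_map. Qed.

Lemma rounds_swap c c' :
  log c' = [seq (~~ e.1, e.2) | e <- log c] -> rounds c' = rounds c.
Proof. by rewrite /rounds => ->; rewrite size_map. Qed.

(** Here [11 = 2 + 9]: the base [b] is at least 2, two factors bound [width p * len p], and
    [b ^ 9 >= 512] absorbs the constants 300, 13 and 10. *)
Lemma bob_poly_bound d p :
  300 * (width p * len p) + 13 * poly_bound d p + 10 <= poly_bound (d + 11) p.
Proof.
rewrite /poly_bound; set b := width p + sec p + len p.
have b2 : 2 <= b by have := width_gt0 p; have := len_gt0 p; rewrite /b; lia.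
have wl : width p * len p <= b ^ 2.
  by rewrite expnS expn1 leq_mul // /b; lia.
have d1 : 0 < b ^ d by rewrite expn_gt0; lia.
have d9 : 2 ^ 9 <= b ^ 9 by rewrite leq_exp2r.
have -> : d + 11 = d + (2 + 9) by lia.
rewrite !expnD; have b4 : 2 ^ 2 <= b ^ 2 by rewrite leq_exp2r.
move: (b ^ d) (b ^ 2) (b ^ 9) d1 wl d9 b4 => x y z x1 wl z9 y4.
have : x * y * 512 <= x * (y * z) by rewrite mulnA leq_mul2l z9 orbT.
nia.
Qed.

Section Main.

Variables (Q : protocol) (w W : param -> nat).
Hypotheses (Q_work : has_work OT Q w) (W_ge : forall p, mask_time p + w p <= W p).

Lemma len_work_le p : len p + w p <= W p.
Proof.
apply: leq_trans (W_ge p); rewrite leq_add2r /mask_time.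
have := width_gt0 p; nia.
Qed.

Lemma Ind_run p (J pi : (logw p).-tuple bool) (y : strings p)
    (mask : (len p).-tuple bool) (tS tC : (w p).-tuple bool) eS eC :
  let cQ := execute Q (w p) p (code_strings (offered pi mask y)) J tS tC in
  let cP := execute (P_Ind Q) (W p) p J (pi ++ code_strings y)
              (tC ++ eC) (mask ++ (tS ++ eS)) in
  finished cP /\ same_run mask cQ cP.
Proof.
move=> cQ cP; apply: P_Ind_run; rewrite ?size_tuple //.
exact: (@Q_work p (offered pi mask y) J).
Qed.

Lemma Ind_tapes p (r1 r2 : (W p).-tuple bool) :
  exists (mask : (len p).-tuple bool) (tS tC : (w p).-tuple bool) eS eC,
    tval r1 = tC ++ eC /\ tval r2 = mask ++ (tS ++ eS).
Proof.
have lw := len_work_le p.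
have [|tC [eC r1E]] := @tuple_cat_ex (w p) (W p - w p) _ r1; first by lia.
have [|mask [r r2E]] := @tuple_cat_ex (len p) (W p - len p) _ r2; first by lia.
have [|tS [eS rE]] := @tuple_cat_ex (w p) (W p - len p - w p) _ r; first by lia.
by exists mask, tS, tC, eS, eC; rewrite r1E r2E rE.
Qed.

Lemma Ind_work : has_work Ind (P_Ind Q) W.
Proof.
move=> p J [pi y] r1 r2.
have [mask [tS [tC [eS [eC [-> ->]]]]]] := Ind_tapes r1 r2.
by have [] := Ind_run J pi y mask tS tC eS eC.
Qed.

Lemma Ind_cost (cost : conf -> nat) :
  (forall c c', log c' = [seq (~~ e.1, e.2) | e <- log c] -> cost c' = cost c) ->
  forall p,
  \max_(i : input1 Ind p * input2 Ind p)
    \max_(r : (W p).-tuple bool * (W p).-tuple bool)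
      cost (final (P_Ind Q) i.1 i.2 r) =
  \max_(i : input1 OT p * input2 OT p)
    \max_(r : (w p).-tuple bool * (w p).-tuple bool)
      cost (final Q i.1 i.2 r).
Proof.
move=> costE p; apply/eqP; rewrite eqn_leq; apply/andP; split.
  apply/bigmax_leqP => -[J [pi y]] _; apply/bigmax_leqP => -[r1 r2] _.
  have [mask [tS [tC [eS [eC [r1E r2E]]]]]] := Ind_tapes r1 r2.
  have [_ [lg _ _ _ _]] := Ind_run J pi y mask tS tC eS eC.
  rewrite /final /= r1E r2E (costE _ _ lg).
  apply: leq_trans (leq_bigmax (offered pi mask y, J)).
  exact: (leq_bigmax (F := fun r : (w p).-tuple bool * (w p).-tuple bool =>
    cost (execute Q (w p) p (code_strings (offered pi mask y)) J r.1 r.2)) (tS, tC)).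
apply/bigmax_leqP => -[x J] _; apply/bigmax_leqP => -[tS tC] _ /=.
(* With pi and pi' zero the strings are offered unchanged, so every run of the oblivious transfer
   occurs inside a run of the protocol, on tapes padded with [false]. This makes the costs equal. *)
pose pi := [tuple of nseq (logw p) false].
pose mask := [tuple of nseq (len p) false].
have lw := len_work_le p.
have s1 : size (tC ++ nseq (W p - w p) false) == W p.
  by rewrite size_cat size_tuple ?size_nseq; lia.
have s2 : size (mask ++ (tS ++ nseq (W p - len p - w p) false)) == W p.
  by rewrite !size_cat !size_tuple ?size_nseq; lia.
have [_ [lg _ _ _ _]] := Ind_run J pi x mask tS tC
  (nseq (W p - len p - w p) false) (nseq (W p - w p) false).
rewrite offered_zero in lg.
rewrite /final /= -(costE _ _ lg).
apply: leq_trans (leq_bigmax (J, (pi, x))).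
exact: (leq_bigmax (F := fun r : (W p).-tuple bool * (W p).-tuple bool =>
  cost (execute (P_Ind Q) (W p) p J (pi ++ code_strings x) r.1 r.2))
  (Tuple s1, Tuple s2)).
Qed.

(** Alice's input and output are coded as the chooser's, so [S] is reused unchanged. The sender
    outputs nothing, so for fixed pi' the two strings differ only by the constant prefix pi', Bob's
    output. *)
Lemma Ind_private1 S d :
  poly_time (sim_code2 (F := OT)) S d ->
  indistinguishable (ideal_dist2 (F := OT) S d) (@real_dist2 OT Q w) ->
  poly_time (sim_code1 (F := Ind)) S d /\
  indistinguishable (ideal_dist1 (F := Ind) S d)
    (@real_dist1 Ind (P_Ind Q) W).
Proof.
move=> Spoly ind; split; first by move=> p z r; apply: (Spoly p z).
move: ind; apply: (indistinguishable_mixture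
  (f := fun p (i : input1 Ind p * input2 Ind p) (mask : (len p).-tuple bool) =>
          (offered i.2.1 mask i.2.2, i.1))
  (h := fun p _ (mask : (len p).-tuple bool) => prefix_wires mask)).
- by move=> p; apply: card_bits.
- move=> p [J [pi y]] C; rewrite prob_accept_avg /= avg_pair /=.
  apply: eq_avg => mask; rewrite prob_accept_avg /= avg_pair /=.
  rewrite avg_const ?card_unit //; apply: eq_avg => r.
  by rewrite accepts_prefix tnth_offered.
- move=> p [J [pi y]] C; rewrite prob_accept_avg /=.
  pose G (mask : (len p).-tuple bool) (tS tC : bitseq) : rat :=
    ((accepts [seq rewire (prefix_wires mask) g | g <- C]
      (view J (execute Q (w p) p (code_strings (offered pi mask y)) J tS tC) true))%:R)%R.
  rewrite (@avg_tapes (len p) (w p) (W p) (fun r1 r2 =>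
    ((accepts C
       (output (len p) (execute (P_Ind Q) (W p) p J (pi ++ code_strings y) r1 r2) true
        ++ view J (execute (P_Ind Q) (W p) p J (pi ++ code_strings y) r1 r2) false))%:R)%R)
    G).
  + by apply: eq_avg => mask; rewrite prob_accept_avg.
  + exact: len_work_le.
  move=> mask tS tC eS eC; rewrite /G accepts_prefix.
  have [_ [lg tsC _ _ o]] := Ind_run J pi y mask tS tC eS eC.
  congr ((nat_of_bool (accepts C _))%:R)%R.
  rewrite /view lg tsC messages_swap; congr (_ ++ _).
  rewrite /output o; apply: (@eq_from_nth _ false).
    by rewrite size_mkseq size_tuple.
  move=> q; rewrite size_mkseq => lt_q; rewrite nth_mkseq // nth_cells.
  by case: nth.
Qed.

(** For fixed pi', Alice's output is the chooser's, so its correlation with the sender's view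
    carries over to Bob's view. Only the encoding of the offered strings has to be replaced, right
    after the first [len p] bits. *)
Lemma Ind_private2 S d :
  poly_time (sim_code1 (F := OT)) S d ->
  indistinguishable (ideal_dist1 (F := OT) S d) (@real_dist1 OT Q w) ->
  poly_time (sim_code2 (F := Ind)) (bob_simulator S) (d + 11) /\
  indistinguishable (ideal_dist2 (F := Ind) (bob_simulator S) (d + 11))
    (@real_dist2 Ind (P_Ind Q) W).
Proof.
move=> Spoly ind.
have dd p : poly_bound d p <= poly_bound (d + 11) p.
  by apply: leq_trans (bob_poly_bound d p); lia.
have sim p pi y mask (r : (poly_bound d p).-tuple bool) e :=
  @bob_simulator_run S p pi y mask r e (poly_bound d p) (poly_bound (d + 11) p)
    (eq_leq (esym (size_tuple r))) (@Spoly p (offered pi mask y, [tuple]) r)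
    (bob_poly_bound d p).
split.
  move=> p [[pi y] mask] r.
  have [|s [t rE]] := @tuple_cat_ex (poly_bound d p)
    (poly_bound (d + 11) p - poly_bound d p) _ r; first by rewrite subnKC.
  rewrite rE; exact: (sim p pi y mask s t).1.
move: ind; apply: (indistinguishable_mixture
  (f := fun p (i : input1 Ind p * input2 Ind p) (mask : (len p).-tuple bool) =>
          (offered i.2.1 mask i.2.2, i.1))
  (h := fun p (i : input1 Ind p * input2 Ind p) (mask : (len p).-tuple bool) =>
     infix_wires (len p) (encode (i.2.1 ++ code_strings i.2.2) ++ pairs mask)
       (size (encode (code_strings (offered i.2.1 mask i.2.2)))))).
- by move=> p; apply: card_bits.
- move=> p [J [pi y]] C; rewrite prob_accept_avg /= avg_pair /=.
  apply: eq_avg => mask; rewrite prob_accept_avg /= avg_pair /=.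
  rewrite avg_const ?card_unit //.
  (* The new simulator has a longer tape than [S]; the surplus coins do not affect its output. *)
  rewrite (@avg_cat (poly_bound d p) (poly_bound (d + 11) p - poly_bound d p)
    _ (fun r => ((accepts C (xort mask (tnth y (string_index (xort pi J))) ++
      sim_output (bob_simulator S) (d + 11) p ((pi ++ code_strings y) ++ mask) r))%:R)%R)).
    apply: eq_avg => r.
    rewrite -[RHS](@avg_const {: (poly_bound (d + 11) p - poly_bound d p).-tuple bool}
      _ (card_bits _)).
    apply: eq_avg => e; rewrite /sim_output (sim p pi y mask r e).2 tnth_offered.
    congr ((nat_of_bool _)%:R)%R.
    rewrite -(accepts_infix _ _ _ C) size_tuple.
    by [].
  by rewrite subnKC.
- move=> p [J [pi y]] C; rewrite prob_accept_avg /=.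
  pose G (mask : (len p).-tuple bool) (tS tC : bitseq) : rat :=
    let cQ := execute Q (w p) p (code_strings (offered pi mask y)) J tS tC in
    ((accepts [seq rewire (infix_wires (len p)
         (encode (pi ++ code_strings y) ++ pairs mask)
         (size (encode (code_strings (offered pi mask y))))) g | g <- C]
      (output (len p) cQ true ++ view (code_strings (offered pi mask y)) cQ false))%:R)%R.
  rewrite (@avg_tapes (len p) (w p) (W p) (fun r1 r2 =>
    let cP := execute (P_Ind Q) (W p) p J (pi ++ code_strings y) r1 r2 in
    ((accepts C (output (len p) cP false ++ view (pi ++ code_strings y) cP true))%:R)%R)
    G).
  + by apply: eq_avg => mask; rewrite prob_accept_avg.
  + exact: len_work_le.
  move=> mask tS tC eS eC; rewrite /G /=.
  have [_ [lg _ tsS o _]] := Ind_run J pi y mask tS tC eS eC.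
  congr ((nat_of_bool _)%:R)%R.
  rewrite /output o -/(output (len p) _ true) -[X in infix_wires X](size_mkseq
    (fun q => nth 0 (arr (thr (execute Q (w p) p
       (code_strings (offered pi mask y)) J tS tC) true).2 aOut) q != 0) (len p)).
  rewrite accepts_infix; congr (accepts C (_ ++ _)).
  (* The sender's real view begins with the encoding of the offered strings, so exactly this is
     dropped. *)
  by rewrite /view lg tsS messages_swap drop_size_cat // (encode_cat mask) -!catA.
Qed.

End Main.

Theorem claim3p1 (Q : protocol) (W_OT : param -> nat)
  (Q_work : has_work OT Q W_OT)
  (Q_linear : exists c0 : nat, forall p : param, width p * len p <= c0 * W_OT p)
  (Q_private : privately_computes OT Q W_OT) :
  exists c : nat,
    let W := fun p : param => c * W_OT p in
    [/\ privately_computes Ind (P_Ind Q) W,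
        forall p : param,
          comm_cost Ind (P_Ind Q) W p = comm_cost OT Q W_OT p,
        has_work Ind (P_Ind Q) W &
        forall p : param,
          round_cost Ind (P_Ind Q) W p = round_cost OT Q W_OT p].
Proof.
(* The preparation takes at most [120 * (width p * len p)] steps, hence at most [120 * c0 * W_OT p];
   the 1 accounts for the oblivious transfer itself. *)
have [c0 linear] := Q_linear; exists (120 * c0 + 1) => W.
have W_ge p : mask_time p + W_OT p <= W p.
  by have := linear p; rewrite /W /mask_time; nia.
have [[S1 [d1 [poly1 ind1]]] [S2 [d2 [poly2 ind2]]]] := Q_private.
split.
- split; first by exists S2, d2; apply: Ind_private1.
  by exists (bob_simulator S1), (d1 + 11); apply: Ind_private2.
- exact: (Ind_cost Q_work W_ge communication_swap).
- exact: (Ind_work Q_work W_ge).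
- exact: (Ind_cost Q_work W_ge rounds_swap).
Qed.
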